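(* For all positive integers $k\geq r\geq 2$, $$\begin{aligned} &\sum_{\substack{1\leq k_1,\dots,k_r\\k_1+\cdots+k_r=k}}\bigl(Z(2k_1,\dots,2k_r)+Z(2k_1-1,2k_2,\dots,2k_{r-1},2k_r+1)\bigr)\\ &=\frac 1{2^{2r-3}}\sum_{j=0}^{\lfloor\frac{r-1}2\rfloor}\frac{(-4\pi^2)^j}{(2j)!}\binom{2r-2j-2}{r-1}Z(2k-2j). \end{aligned}$$
   Context: For a complex number $a$ and a nonnegative integer $n$, let $(a)_0=1$ and $(a)_n=a(a+1)\cdots(a+n-1)$ for $n>0$. For $r\ge 1$ and positive integers $k_1,\dots,k_r$ with $k_r\geq 2$, define $$Z(k_1,\dots,k_r)=\sum_{0\leq n_1<\cdots<n_r}\frac{\left(\frac12\right)_{n_1}}{n_1!}\,\frac{1}{\left(n_1+\frac12\right)^{k_1}\cdots \left(n_r+\frac12\right)^{k_r}}\,\frac{n_r!}{\left(\frac12\right)_{n_r}},$$ where the sum is over integers $n_1,\dots,n_r$. In particular $Z(k)$ denotes the case $r=1$. The sum on the left-hand side of the claim is over $r$-tuples of positive integers $(k_1,\dots,k_r)$ with sum $k$; for $r=2$ the second summand is $Z(2k_1-1,2k_2+1)$. *)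

(* Defs.v *)
From HB Require Import structures.
From mathcomp Require Import all_boot all_order all_algebra.
From mathcomp Require Import all_classical all_reals all_analysis.

Set Implicit Arguments.
Unset Strict Implicit.
Unset Printing Implicit Defensive.

Import Order.TTheory GRing.Theory Num.Theory.

Local Open Scope classical_set_scope.
Local Open Scope ring_scope.

Definition pochhammer (R : pzRingType) (a : R) (n : nat) : R :=
  \prod_(i < n) (a + i%:R).

(* [head 0 n] and [last 0 n] are n_1 and n_r; only r >= 1 is meaningful. *)
Definition Zterm (R : realType) (r : nat) (k n : r.-tuple nat) : R :=
  pochhammer 2^-1 (head 0%N n) / (head 0%N n)`!%:R
  * (\prod_(i < r) ((tnth n i)%:R + 2^-1) ^+ tnth k i)^-1
  * ((last 0%N n)`!%:R / pochhammer 2^-1 (last 0%N n)).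

(* All terms are positive, so the multiple series is the unordered sum over
   strictly increasing tuples. It is kept in the extended reals, where
   divergence shows up as +oo and no default value is needed. *)
Definition Z (R : realType) (r : nat) (k : r.-tuple nat) : \bar R :=
  \esum_(n in [set n : r.-tuple nat | sorted ltn n]) (Zterm R k n)%:E.

(* Parts are taken in 'I_k.+1 only to make the index type finite. *)
Definition is_composition (k r : nat) (t : r.-tuple 'I_k.+1) : bool :=
  [forall i, (0 < tnth t i)%N] && (\sum_(i < r) tnth t i == k)%N.

Definition double_index (k r : nat) (t : r.-tuple 'I_k.+1) : r.-tuple nat :=
  [tuple (2 * tnth t i)%N | i < r].

(* (2k_1 - 1, 2k_2, ..., 2k_(r-1), 2k_r + 1): the booleans are read as 0 or 1,
   and the truncated subtraction is exact because k_1 >= 1. *)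
Definition shifted_index (k r : nat) (t : r.-tuple 'I_k.+1) : r.-tuple nat :=
  [tuple (2 * tnth t i - (i == 0 :> nat) + (i == r.-1 :> nat))%N | i < r].

(* Main.v *)
Require Import Defs.
From mathcomp Require Import all_boot all_order all_algebra.
From mathcomp Require Import all_classical all_reals all_analysis.
From mathcomp Require Import ring lra.

(** Put a_n = n + 1/2, A_n = a_n^2 and w_n = (1/2)_n / n!. For a fixed chain
    n_1 < ... < n_r, the summands on the left add up, over all compositions, to
    (w_(n_1) / w_(n_r)) (1 + a_(n_1) / a_(n_r)) times the sum of the products
    prod_i A_(n_i)^(- k_i). By partial fractions ([coef_prod_parts]) the latter is
    the sum, over the entries n of the chain, of A_n^(r - 1 - k) times the product
    of 1 / (A_m - A_n) over the other entries m. The left-hand side is therefore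
    the sum over n of A_n^(r - 1 - k) S_r(n), where the residue S_r(n) collects the
    chains of length r through n and is independent of k. It remains to evaluate
    S_r(n).

    A chain through n splits into a part below and a part above n, so the
    generating function of the S_r(n) y^(r - 1) is a sum of two products l_i u_i,
    one for each summand of 1 + a_(n_1) / a_(n_r) ([sum_chains_through]). In the
    variable v = A_n - y the l_i are terminating and the u_i infinite
    hypergeometric series. Going from n to n + 1 acts on (l_1, l_2) by a matrix
    whose transpose takes (u_1, u_2) from n + 1 back to n ([lowerS1], [lowerS2],
    [upper_telescope]); hence, after division by 2 (-1)^n a_n, the sum
    l_1 u_1 + l_2 u_2 is the same function of v for all n ([pairing_cvg]). For
    n = 0 it is a Gauss series with sum sin(pi b) / b, where b^2 = v
    ([sum_gauss_cvg]). So S_r(n) is the coefficient of y^(r - 1) in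
    2 (-1)^n a_n f(A_n - y), where f(v) = sin(pi sqrt v) / sqrt v.

    The function f satisfies 4 v f'' + 6 f' + pi^2 f = 0, so its Taylor
    coefficients at A_n obey a recurrence of order two. As sin(pi a_n) = (-1)^n
    and cos(pi a_n) = 0, its initial values are free of trigonometric functions,
    and the solution is a polynomial in pi^2 whose coefficients are, up to
    elementary factors, the binomials of the statement ([taylor_sum_cvg]). Substituting it for S_r(n) and summing over
    n gives the right-hand side.

    The analysis is done on truncations, with all entries below N. Positivity
    makes the multiple sums limits of these ([esum_sorted_tuples]); a bound on the
    residues that is uniform in N ([sum_chains_abs_le]) lets the limit pass to
    the coefficients of y ([coef_cvg0]) and through the sum over n ([tannery]). *)

Set Implicit Arguments.
Unset Strict Implicit.
Unset Printing Implicit Defensive.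

Import Order.TTheory GRing.Theory Num.Theory.
Local Open Scope ring_scope.
Import numFieldNormedType.Exports.
Local Open Scope classical_set_scope.

(** * Compositions and partial fractions *)

Section PartialFractions.
Variable F : fieldType.
Implicit Types (x z : F) (s : seq F).

(** The rational function [t |-> \prod_(z <- s) z / (t - z)] has residue
    [x * residue_factor s x] at an entry [x] of [s]. *)
Definition residue_factor s x := \prod_(z <- s | z != x) (z / (x - z)).

Lemma residue_factor_cons z s x : z != x ->
  residue_factor (z :: s) x = z / (x - z) * residue_factor s x.
Proof. by move=> zx; rewrite /residue_factor big_cons zx. Qed.

Lemma residue_factor_notin s x : x \notin s ->
  residue_factor s x = \prod_(z <- s) (z / (x - z)).
Proof.
move=> xs; rewrite /residue_factor big_seq_cond [RHS]big_seq.
by apply: eq_bigl => z; case: (z \in s) / boolP => //= zs; apply: contraNneq xs => <-.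
Qed.

(** Adding a pole [b] multiplies each term by a factor [b / (x - b)]; splitting
    [x / (y - x) * (b / (x - b))] into simple fractions turns the new sum into
    [b / (y - b)] times the difference of the old sums at [y] and at [b], and
    the second of these cancels the term of [b]. *)
Lemma prod_partial_fractions s y : uniq s -> y \notin s -> (0 < size s)%N ->
  \sum_(x <- s) x / (y - x) * residue_factor s x = \prod_(x <- s) (x / (y - x)).
Proof.
elim: s y => [//|b s IH] y /=.
case: (posnP (size s)) => [/size0nil -> _ _ _|s_gt0].
  by rewrite !big_seq1 /residue_factor big_cons eqxx big_nil /= mulr1.
move=> /andP[bs us]; rewrite inE negb_or => /andP[yb ys] _.
rewrite !big_cons.
have -> : residue_factor (b :: s) b = \prod_(z <- s) (z / (b - z)).
  by rewrite /residue_factor big_cons eqxx /= -residue_factor_notin.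
rewrite -(IH b us bs) // -(IH y us ys) //.
rewrite mulr_sumr mulr_sumr -big_split /= !big_seq.
apply: eq_bigr => x xs.
have bx : b != x by apply: contraNneq bs => ->.
have yx : y != x by apply: contraNneq ys => ->.
rewrite residue_factor_cons //.
by field; rewrite !subr_eq0 yx yb bx eq_sym bx.
Qed.

(** Truncated geometric series x T + x^2 T^2 + ..., so that products of these
    enumerate compositions by the exponent of T. *)
Definition parts_poly (K : nat) x : {poly F} :=
  \poly_(j < K.+1) (if (0 < j)%N then x ^+ j else 0).

Lemma geometric_difference x y k : x != y -> (0 < k)%N ->
  \sum_(j < k.+1 | (0 < j < k)%N) x ^+ j * y ^+ (k - j) =
    y ^+ k * (x / (y - x)) - x ^+ k * (y / (y - x)).
Proof.
move=> xy; have yx : y - x != 0 by rewrite subr_eq0 eq_sym.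
case: k => // k _; elim: k => [|k IH].
  rewrite big_mkcond !big_ord_recl big_ord0 /=; ring.
rewrite big_mkcond big_ord_recr /=.
rewrite [X in _ + X = _](_ : _ = 0) ?addr0; last by rewrite ifN // -leqNgt.
rewrite big_ord_recr /= ltnSn subSnn.
transitivity (y * (\sum_(j < k.+2 | (0 < j < k.+1)%N) x ^+ j * y ^+ (k.+1 - j))
   + x ^+ k.+1 * y); last by rewrite IH !exprS; field.
congr (_ + _); rewrite [in RHS]big_mkcond [in RHS]big_ord_recr /=.
rewrite [X in _ * (_ + X)](_ : _ = 0) ?addr0; last by rewrite ifN // -leqNgt.
rewrite mulr_sumr.
apply: eq_bigr => j _; have jk := ltn_ord j.
have jk2 : (j < k.+2)%N by rewrite ltnS ltnW.
rewrite jk jk2 !andbT.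
by case: ifP => _; rewrite ?mulr0 // (subSn (ltnW jk)) exprS mulrCA.
Qed.

Lemma coef0_prod_parts K s : (0 < size s)%N -> (\prod_(x <- s) parts_poly K x)`_0 = 0.
Proof.
by case: s => // x s _; rewrite big_cons coef0M coef_poly /= mul0r.
Qed.

(** Summing a geometric series over the part assigned to a new entry [b] gives
    each old pole its new factor; what remains is [b ^+ k] times the sum that
    [prod_partial_fractions] evaluates at [b], which is the term of [b]. *)
Lemma coef_prod_parts K s k : uniq s -> (0 < size s)%N -> (0 < k <= K)%N ->
  (\prod_(x <- s) parts_poly K x)`_k = \sum_(x <- s) x ^+ k * residue_factor s x.
Proof.
elim: s k => [//|b s IH] k.
case: (posnP (size s)) => [/size0nil -> _ _ /andP[k0 kK]|s_gt0].
  rewrite !big_seq1 coef_poly ltnS kK k0 /residue_factor big_cons eqxx big_nil.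
  by rewrite /= mulr1.
rewrite cons_uniq => /andP[bs us] _ /andP[k0 kK].
rewrite [in RHS]big_cons big_cons coefM.
transitivity (\sum_(j < k.+1 | (0 < j < k)%N) b ^+ j * \sum_(x <- s) x ^+ (k - j) * residue_factor s x).
  rewrite [RHS]big_mkcond; apply: eq_bigr => j _.
  rewrite coef_poly ltnS (leq_trans (leq_ord j) kK).
  case: (posnP j) => [|j0] /=; first by rewrite mul0r.
  case: (ltnP j k) => [jk|]; first by rewrite IH // subn_gt0 jk (leq_trans (leq_subr _ _)).
  by move=> kj; rewrite (eqP kj) coef0_prod_parts // mulr0.
under [LHS]eq_bigr => j _ do rewrite mulr_sumr.
rewrite exchange_big /=.
transitivity (\sum_(x <- s) (x ^+ k * (b / (x - b)) - b ^+ k * (x / (x - b))) * residue_factor s x).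
  rewrite !big_seq; apply: eq_bigr => x xs.
  rewrite -geometric_difference //; last by apply: contraNneq bs => ->.
  by rewrite mulr_suml; apply: eq_bigr => j _; rewrite mulrA.
have -> : residue_factor (b :: s) b = \prod_(z <- s) (z / (b - z)).
  by rewrite /residue_factor big_cons eqxx /= -residue_factor_notin.
rewrite -prod_partial_fractions // mulr_sumr -big_split /= !big_seq.
apply: eq_bigr => x xs.
have bx : b != x by apply: contraNneq bs => ->.
rewrite residue_factor_cons //.
by field; rewrite !subr_eq0 bx eq_sym bx.
Qed.

Lemma sum_compositions (K k r : nat) (x : 'I_r -> F) :
  \sum_(t : r.-tuple 'I_K.+1 | [forall i, (0 < tnth t i)%N] && (\sum_(i < r) tnth t i == k)%N)
     \prod_(i < r) x i ^+ tnth t i =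
  (\prod_(i < r) parts_poly K (x i))`_k.
Proof.
have -> : \prod_(i < r) parts_poly K (x i) = \prod_(i < r)
    \sum_(j < K.+1) (if (0 < j)%N then x i ^+ j else 0) *: 'X^j.
  by apply: eq_bigr => i _; rewrite /parts_poly poly_def.
rewrite bigA_distr_bigA /= coef_sum big_mkcond /=.
rewrite (reindex (fun f : {ffun 'I_r -> 'I_K.+1} => [tuple f i | i < r])) /=; last first.
  exists (fun t : r.-tuple 'I_K.+1 => [ffun i => tnth t i]) => [f _|t _].
    by apply/ffunP => i; rewrite ffunE tnth_mktuple.
  by apply: eq_from_tnth => i; rewrite tnth_mktuple ffunE.
apply: eq_bigr => f _.
have -> : \prod_(i < r) ((if (0 < f i)%N then x i ^+ f i else 0) *: 'X^(f i)) =
  (\prod_(i < r) (if (0 < f i)%N then x i ^+ f i else 0)) *: 'X^(\sum_(i < r) f i) :> {poly F}.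
  rewrite scaler_prod; congr (_ *: _).
  by rewrite -expr_sum.
rewrite coefZ coefXn.
have tf i : tnth [tuple f i | i < r] i = f i by rewrite tnth_mktuple.
have -> : [forall i, 0 < tnth [tuple f i | i < r] i]%N = [forall i, 0 < f i]%N.
  by apply: eq_forallb => i; rewrite tf.
have -> : (\sum_(i < r) tnth [tuple f i | i < r] i = \sum_(i < r) f i)%N.
  by apply: eq_bigr => i _; rewrite tf.
have -> : \prod_(i < r) x i ^+ tnth [tuple f i | i < r] i = \prod_(i < r) x i ^+ f i.
  by apply: eq_bigr => i _; rewrite tf.
rewrite [k == _]eq_sym.
case: eqP => _; rewrite ?andbF ?mulr0 // andbT mulr1.
case: forallP => [h|]; first by apply: eq_bigr => i _; rewrite h.
move=> /forallP; rewrite negb_forall => /existsP[i /negbTE hi].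
by rewrite (bigD1 i) //= hi mul0r.
Qed.
End PartialFractions.

(** * Sums over finite increasing sequences *)

(** New chains arise by appending the largest entry, so sums over chains obey a
    recursion in the bound, and the last entry is under control. *)
Fixpoint chains (N : nat) : seq (seq nat) :=
  if N is M.+1 then chains M ++ [seq rcons s M | s <- chains M] else [:: [::]].

Lemma mem_chains N s : (s \in chains N) = sorted ltn s && all (gtn N) s.
Proof.
elim: N s => [|N IH] s; first by rewrite inE; case: s => //= x s; rewrite andbF.
rewrite /= mem_cat IH.
case/lastP: s => [//|s x].
have -> : (rcons s x \in [seq rcons s0 N | s0 <- chains N]) = (x == N) && (s \in chains N).
  apply/mapP/andP => [[t tN /eqP]|[/eqP -> sN]]; last by exists s.
  by rewrite eqseq_rcons => /andP[/eqP -> /eqP ->].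
have srt : sorted ltn (rcons s x) = sorted ltn s && all (gtn x) s.
  have tr : transitive (fun m n : nat => n < m)%N by move=> a b c /= h1 h2; apply: ltn_trans h1.
  rewrite -[rcons s x]revK -rev_sorted rev_rcons revK /= path_sortedE // andbC.
  by rewrite all_rev /= rev_sorted.
rewrite IH srt !all_rcons /=.
have [xN|Nx|->] := ltngtP x N.
- rewrite orbF ltnS (ltnW xN) /=.
  case: (sorted ltn s) => //=; case: (boolP (all _ s)) => //= h.
  have -> : all (gtn N) s by apply: sub_all h => y /= /ltn_trans; apply.
  by apply/esym; apply: sub_all h => y /= yx; rewrite ltnS (leq_trans (ltnW yx)) // ltnW.
- by rewrite /= ltnS leqNgt Nx /= !andbF.
- rewrite ltnS leqnn /= andbF /=.
  case: (sorted ltn s) => //=; case: (boolP (all _ s)) => //= h.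
  by apply/esym; apply: sub_all h => y /= yx; rewrite ltnS ltnW.
Qed.

Lemma chains_uniq N : uniq (chains N).
Proof.
elim: N => //= N IH; rewrite cat_uniq IH map_inj_uniq ?IH ?andbT /=; last exact: rcons_injl.
apply/hasPn => _ /mapP[s _ ->]; apply/negP; rewrite mem_chains all_rcons /= ltnn.
by rewrite andbF.
Qed.

Lemma mem_chain_uniq N s : s \in chains N -> uniq s.
Proof. by rewrite mem_chains => /andP[/(sorted_uniq ltn_trans ltnn)]. Qed.

Lemma mem_chain_lt N s n : s \in chains N -> n \in s -> (n < N)%N.
Proof. by rewrite mem_chains => /andP[_ /allP h] /h. Qed.

Section ChainSums.
Variables (K : comPzRingType) (x : nat -> K).
Implicit Types (f g : nat -> K) (n N : nat).

Lemma sum_chainsS N (P : pred (seq nat)) (F : seq nat -> K) :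
  \sum_(s <- chains N.+1 | P s) F s =
  \sum_(s <- chains N | P s) F s + \sum_(s <- chains N | P (rcons s N)) F (rcons s N).
Proof. by rewrite /= big_cat big_map. Qed.

(** Sum over the chains below [N] of the weight [f] of the least entry times the
    product of the [x m]: the index [p] is the least entry, and [f n] is the
    share of the empty chain. The dual [upper_sum] is indexed by the greatest
    entry. *)
Definition lower_sum f n N :=
  f n + \sum_(0 <= p < N) f p * x p * \prod_(p.+1 <= m < N) (1 + x m).

Definition upper_sum g n N :=
  g n + \sum_(n.+1 <= q < N) g q * x q * \prod_(n.+1 <= m < q) (1 + x m).

Lemma lower_sumS f n N : lower_sum f n N.+1 = lower_sum f n N + lower_sum f N N * x N.
Proof.
rewrite /lower_sum big_nat_recr //= [\prod_(N.+1 <= _ < _) _]big_geq // mulr1.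
rewrite -[RHS]addrA; congr (_ + _); rewrite mulrDl addrCA addrC; congr (_ + _).
rewrite -[X in _ = X + _]mulr1 -mulrDr mulr_suml; rewrite !big_nat.
by apply: eq_bigr => p /andP[_ pN]; rewrite big_nat_recr //= mulrA.
Qed.

Lemma lower_sum_one n N : lower_sum (fun=> 1) n N = \prod_(0 <= m < N) (1 + x m).
Proof.
elim: N n => [|N IH] n; first by rewrite /lower_sum !big_geq // addr0.
by rewrite lower_sumS !IH big_nat_recr //= mulrDr mulr1.
Qed.

Lemma sum_chains_head f n N :
  \sum_(s <- chains N) f (head n s) * \prod_(m <- s) x m = lower_sum f n N.
Proof.
elim: N n => [|N IH] n.
  by rewrite /lower_sum /= big_seq1 big_nil big_geq // mulr1 addr0.
rewrite sum_chainsS IH lower_sumS; congr (_ + _).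
rewrite -IH mulr_suml; apply: eq_bigr => s _.
have -> : head n (rcons s N) = head N s by case: s.
by rewrite -cats1 big_cat big_seq1 mulrA.
Qed.

Lemma sum_chains_through_head f n N : (n < N)%N ->
  \sum_(s <- chains N | n \in s) f (head 0%N s) * \prod_(m <- s | m != n) x m =
  lower_sum f n n * \prod_(n.+1 <= m < N) (1 + x m).
Proof.
elim: N => // N IH; rewrite ltnS leq_eqVlt => /predU1P[nN|nN]; rewrite sum_chainsS.
  rewrite -nN {IH} big_seq_cond big1 => [|s /andP[sn ns]]; last first.
    by have := mem_chain_lt sn ns; rewrite ltnn.
  rewrite add0r big_geq // mulr1 -sum_chains_head.
  rewrite big_seq_cond [RHS]big_seq; apply: eq_big => s; first by rewrite mem_rcons mem_head andbT.
  move=> /andP[sn _]; have -> : head 0%N (rcons s n) = head n s by case: (s).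
  rewrite -cats1 big_cat big_cons eqxx big_nil /= mulr1.
  congr (_ * _); rewrite big_seq_cond [RHS]big_seq; apply: eq_bigl => m.
  case: (boolP (m \in s)) => //= ms; apply: contraTneq (mem_chain_lt sn ms) => ->.
  by rewrite ltnn.
rewrite IH // big_nat_recr //= [in RHS]mulrA mulrDr mulr1 -IH //; congr (_ + _).
rewrite mulr_suml; apply: eq_big => s; first by rewrite mem_rcons inE ltn_eqF.
rewrite mem_rcons inE ltn_eqF //= => ns.
rewrite -cats1 big_cat big_cons big_nil gtn_eqF //= mulr1 mulrA.
by congr (_ * _); case: s ns.
Qed.

(** A chain through [n] consists of a chain below [n] and a chain above [n]; its
    head is decided by the first and its last entry by the second, hence the
    sum factors. *)
Lemma sum_chains_through f g n N : (n < N)%N ->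
  \sum_(s <- chains N | n \in s)
     f (head 0%N s) * g (last 0%N s) * \prod_(m <- s | m != n) x m =
  lower_sum f n n * upper_sum g n N.
Proof.
elim: N => // N IH; rewrite ltnS leq_eqVlt => /predU1P[nN|nN]; rewrite sum_chainsS.
  rewrite -nN {IH} big_seq_cond big1 => [|s /andP[sn ns]]; last first.
    by have := mem_chain_lt sn ns; rewrite ltnn.
  have := sum_chains_through_head f (ltnSn n).
  rewrite sum_chainsS big_seq_cond big1 => [|s /andP[sn ns]]; last first.
    by have := mem_chain_lt sn ns; rewrite ltnn.
  rewrite /upper_sum !big_geq // addr0 !add0r mulr1 => <-.
  by rewrite mulr_suml; apply: eq_bigr => s _; rewrite last_rcons mulrAC.
rewrite IH // /upper_sum [in RHS]big_nat_recr //= [in RHS]addrA [RHS]mulrDr; congr (_ + _).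
rewrite [X in _ * X](_ : _ = \prod_(n.+1 <= m < N) (1 + x m) * (g N * x N)); last by rewrite mulrC.
rewrite mulrA -sum_chains_through_head // mulr_suml.
apply: eq_big => s; first by rewrite mem_rcons inE ltn_eqF.
rewrite mem_rcons inE ltn_eqF //= => ns; rewrite last_rcons.
rewrite -cats1 big_cat big_cons big_nil gtn_eqF //= mulr1.
have -> : head 0%N (s ++ [:: N]) = head 0%N s by case: s ns.
ring.
Qed.
End ChainSums.

(** * Limits of real sequences *)

Lemma cvg_near_eq (R : realType) (g f : nat -> R) (l : R) :
  (\forall N \near \oo, f N = g N) -> f N @[N --> \oo] --> l -> g N @[N --> \oo] --> l.
Proof. by move=> fg; apply: cvg_trans; exact: near_eq_cvg. Qed.

Lemma cvg_cstM (R : realType) (k : R) (f : nat -> R) (l : R) :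
  f N @[N --> \oo] --> l -> k * f N @[N --> \oo] --> k * l.
Proof. exact: cvgMl_tmp. Qed.

Lemma cvg_finite_sum (R : realType) (I : Type) (r : seq I) (P : pred I)
    (f : I -> nat -> R) (l : I -> R) :
  (forall i, P i -> f i N @[N --> \oo] --> l i) ->
  \sum_(i <- r | P i) f i N @[N --> \oo] --> \sum_(i <- r | P i) l i.
Proof.
move=> fl; elim: r => [|i r IH].
  rewrite big_nil [X in X @ _](_ : _ = cst 0); first exact: cvg_cst.
  by apply/funext => N; rewrite big_nil.
rewrite big_cons [X in X @ _](_ : _ = fun N => if P i
    then f i N + \sum_(i <- r | P i) f i N else \sum_(i <- r | P i) f i N).
  by case: ifP => [/fl fi|_ //]; exact: cvgD.
by apply/funext => N; rewrite big_cons.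
Qed.

(** * Estimates by derivatives *)

Section Derivatives.
Variable R : realType.
Implicit Types (f g : R -> R) (x a b : R).

Lemma is_derive_mul f g x a b : is_derive x 1 f a -> is_derive x 1 g b ->
  is_derive x 1 (fun t => f t * g t) (a * g x + f x * b).
Proof.
move=> hf hg; apply: (@is_derive_eq _ _ _ (f * g) _ _ _ _ (is_deriveM hf hg)).
have -> : f x *: b + g x *: a = f x * b + g x * a by [].
ring.
Qed.

Lemma is_derive_add f g x a b : is_derive x 1 f a -> is_derive x 1 g b ->
  is_derive x 1 (fun t => f t + g t) (a + b).
Proof. by move=> hf hg; exact: (is_deriveD hf hg). Qed.

Lemma is_derive_scale f k x a : is_derive x 1 f a -> is_derive x 1 (fun t => k * f t) (k * a).
Proof. by move=> hf; exact: (is_deriveZ k hf). Qed.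

Lemma is_derive_pow f n x a : is_derive x 1 f a ->
  is_derive x 1 (fun t => f t ^+ n) (n%:R * f x ^+ n.-1 * a).
Proof.
by move=> hf; rewrite -exprfctE; exact: (is_deriveX n hf).
Qed.

Lemma derive_ge0_le f (df : R -> R) a b : a <= b ->
  (forall x, is_derive x 1 f (df x)) -> (forall x, a < x < b -> 0 <= df x) ->
  f a <= f b.
Proof.
rewrite le_eqVlt => /predU1P[-> //|ab] hf df0.
have [|c] := @MVT R f df a b ab (fun x _ => hf x).
  apply: derivable_within_continuous => x _; exact: (@ex_derive _ _ _ _ _ _ _ (hf x)).
rewrite in_itv /= => /df0 c0 h; rewrite -subr_ge0 h mulr_ge0 // subr_ge0 ltW //.
Qed.

Lemma derive_norm_le f (df : R -> R) g (dg : R -> R) a b : a <= b ->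
  (forall x, is_derive x 1 f (df x)) -> (forall x, is_derive x 1 g (dg x)) ->
  (forall x, a < x < b -> `|df x| <= dg x) ->
  `|f b - f a| <= g b - g a.
Proof.
move=> ab hf hg h; rewrite ler_norml; apply/andP; split.
  have := @derive_ge0_le (fun x => g x + f x) (fun x => dg x + df x) a b ab.
  have H1 x : is_derive x 1 (fun x => g x + f x) (dg x + df x) by exact: is_derive_add.
  have H2 x : a < x < b -> 0 <= dg x + df x.
    by move/h; rewrite ler_norml => /andP[]; lra.
  by move=> /(_ H1 H2); lra.
have := @derive_ge0_le (fun x => g x + (-1) * f x) (fun x => dg x + (-1) * df x) a b ab.
have H1 x : is_derive x 1 (fun x => g x + (-1) * f x) (dg x + (-1) * df x).
  by apply: is_derive_add => //; exact: is_derive_scale.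
have H2 x : a < x < b -> 0 <= dg x + (-1) * df x.
  by move/h; rewrite ler_norml => /andP[]; lra.
by move=> /(_ H1 H2); lra.
Qed.

Lemma sin_norm_le x : 0 <= x -> `|sin x| <= x.
Proof.
move=> x0; have h := derive_norm_le x0 (fun y => is_derive_sin y) (fun y => is_derive_id y 1).
rewrite -[X in `|X|]subr0 -(@sin0 R) -[leRHS]subr0; apply: h => y _.
rewrite ler_norml; apply/andP; split; [exact: cos_geN1 | exact: cos_le1].
Qed.

(** A weak form of Jordan's inequality: [y * cos y <= sin y] at [y = x / 2]
    gives [sin x >= x * cos (x / 2) ^+ 2], and [cos (x / 2) ^+ 2 >= 1 / 2]. *)
Lemma half_le_sin x : 0 <= x <= pi / 2 -> x <= 2 * sin x.
Proof.
move=> /andP[x0 x1].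
have pi0 : 0 < pi :> R := pi_gt0 R.
have D (y : R) : is_derive y 1 (fun t : R => sin t + (-1) * (t * cos t)) (y * sin y).
  apply: (is_derive_eq (is_derive_add (is_derive_sin y) (is_derive_scale (-1)
    (is_derive_mul (is_derive_id y 1) (is_derive_cos y))))).
  by ring.
have h (y : R) : 0 <= y <= pi / 2 -> y * cos y <= sin y.
  move=> /andP[y0 y1]; have := derive_ge0_le y0 D; rewrite sin0 mul0r mulr0 addr0.
  have H (z : R) : 0 < z < y -> 0 <= z * sin z.
    move=> /andP[z0 zy]; rewrite mulr_ge0 ?(ltW z0) // sin_ge0_pi //; apply/andP; split; lra.
  by move=> /(_ H); lra.
have h2 : x / 2 * cos (x / 2) <= sin (x / 2) by apply: h; apply/andP; split; lra.
have c0 : 0 <= cos (x / 2) by apply: cos_ge0_pihalf; apply/andP; split; lra.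
have cx : 0 <= cos x by apply: cos_ge0_pihalf; apply/andP; split; lra.
have e1 : sin x = 2 * sin (x / 2) * cos (x / 2).
  by rewrite [in LHS](splitr x) sinD; ring.
have e2 : cos x = 2 * cos (x / 2) ^+ 2 - 1.
  have := cos2Dsin2 (x / 2); rewrite [in X in X = _ -1](splitr x) cosD; lra.
have : x / 2 * cos (x / 2) * cos (x / 2) <= sin (x / 2) * cos (x / 2) by rewrite ler_wpM2r.
have : x / 2 * 1 <= x / 2 * (2 * cos (x / 2) ^+ 2) by rewrite ler_wpM2l //; lra.
rewrite e1; lra.
Qed.

End Derivatives.

(** * Coefficients of pointwise convergent polynomials *)

Section Coefficients.
Variable R : realType.
Implicit Types (p : {poly R}) (C y : R).

Lemma horner_norm_le p C y : 0 <= y <= 2^-1 -> (forall i, `|p`_i| <= C) ->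
  `|p.[y]| <= 2 * C.
Proof.
move=> /andP[y0 y1]; move: {2}(size p) (leqnn (size p)) => n.
elim: n p => [|n IH] p sp hC.
  have C0 : 0 <= C by apply: le_trans (hC 0%N).
  by move: sp; rewrite leqn0 size_poly_eq0 => /eqP ->; rewrite horner0 normr0 mulr_ge0.
have C0 : 0 <= C by apply: le_trans (hC 0%N).
rewrite -(poly_take_drop 1 p) hornerD hornerM hornerXn expr1.
have -> : (take_poly 1 p).[y] = p`_0.
  by rewrite horner_poly big_ord1 expr0 mulr1.
have := IH (drop_poly 1 p); rewrite size_drop_poly leq_subLR add1n sp => /(_ isT).
move=> /(_ (fun i => _)) h.
have {}h : `|(drop_poly 1 p).[y]| <= 2 * C by apply: h => i; rewrite coef_drop_poly.
apply: le_trans (ler_normD _ _) _; rewrite normrM (ger0_norm y0).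
have : `|(drop_poly 1 p).[y]| * y <= 2 * C * 2^-1 by rewrite ler_pM.
have := hC 0%N; lra.
Qed.

(** Convergence of the values on an interval passes to the coefficients when
    these are uniformly bounded: once the coefficients below [s] tend to 0, the
    one of index [s] is [(P N).[y] / y ^+ s] up to a quantity that tends to 0
    and an error of at most [2 * C * y], where [y] is as small as desired. *)
Lemma coef_cvg0 (P : nat -> {poly R}) C (rho : R) : 0 < rho ->
  (forall N i, `|(P N)`_i| <= C) ->
  (forall y, 0 < y < rho -> (P N).[y] @[N --> \oo] --> (0 : R)) ->
  forall s, (P N)`_s @[N --> \oo] --> (0 : R).
Proof.
move=> rho0 hC hP; elim/ltn_ind => s IH.
have C0 : 0 <= C by apply: le_trans (hC 0%N 0%N).
apply/cvgr0Pnorm_le => e e0.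
(* With this [y] the error bound [2 * C * y] is at most [e / 2]. *)
pose y := Num.min (rho / 2) (Num.min 2^-1 (e / (4 * C + 1))).
have c1 : 0 < 4 * C + 1 by rewrite ltr_wpDl // mulr_ge0.
have y0 : 0 < y by rewrite !lt_min invr_gt0 ltr0n /= !divr_gt0.
have y1 : y <= 2^-1 by rewrite !ge_min lexx orbT.
have yr : y < rho.
  apply: le_lt_trans (_ : rho / 2 < _); first by rewrite ge_min lexx.
  by rewrite ltr_pdivrMr // ltr_pMr // ltr1n.
have ye : 2 * C * y <= e / 2.
  have : y <= e / (4 * C + 1) by rewrite !ge_min lexx !orbT.
  rewrite ler_pdivlMr // => h; nra.
have H : (y ^+ s)^-1 * ((P N).[y] - \sum_(i < s) (P N)`_i * y ^+ i) @[N --> \oo] --> (0 : R).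
  have h1 : \sum_(i < s) (P N)`_i * y ^+ i @[N --> \oo] --> \sum_(i < s) (0 : R) * y ^+ i.
    apply: (@cvg_finite_sum R _ _ _ (fun (i : 'I_s) N => (P N)`_i * y ^+ i)) => i _.
    by apply: cvgMr_tmp; exact: IH.
  have h2 := cvgB (hP y (introT andP (conj y0 yr))) h1.
  have h3 := @cvg_cstM R (y ^+ s)^-1 _ _ (h2 _).
  rewrite [X in _ --> X](_ : _ = 0) in h3; first exact: h3.
  by rewrite big1 ?subr0 ?mulr0 // => i _; rewrite mul0r.
move/cvgr0Pnorm_le : H => /(_ (e / 2)); rewrite divr_gt0 // => /(_ isT) H.
near=> N.
have hN : `|(y ^+ s)^-1 * ((P N).[y] - \sum_(i < s) (P N)`_i * y ^+ i)| <= e / 2 by near: N; exact: H.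
have ys : y ^+ s != 0 by rewrite expf_neq0 // gt_eqF.
have -> : (P N)`_s = (y ^+ s)^-1 * ((P N).[y] - \sum_(i < s) (P N)`_i * y ^+ i)
    - (drop_poly s.+1 (P N)).[y] * y.
  have -> : (P N).[y] = \sum_(i < s) (P N)`_i * y ^+ i + (P N)`_s * y ^+ s
      + (drop_poly s.+1 (P N)).[y] * (y * y ^+ s).
    rewrite -{1}(poly_take_drop s.+1 (P N)) hornerD hornerM hornerXn.
    by rewrite horner_poly big_ord_recr /= exprS.
  by field.
apply: le_trans (ler_normB _ _) _; rewrite [e](splitr e) lerD //.
rewrite normrM (ger0_norm (ltW y0)); apply: le_trans ye.
rewrite ler_wpM2r ?(ltW y0) //; apply: horner_norm_le; first by rewrite (ltW y0).
by move=> i; rewrite coef_drop_poly.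
Unshelve. all: by end_near. Qed.

End Coefficients.

(** * Dominated convergence and unordered sums *)

Section Tannery.
Variable R : realType.

(** Tannery's theorem: the tail of the sum is dominated by that of the
    convergent series of the [g n], and the remaining finitely many terms tend
    to 0 one by one. *)
Lemma tannery (g : nat -> R) (D : nat -> nat -> R) (B : R) :
  (forall N, \sum_(0 <= n < N) g n <= B) ->
  (forall n N, `|D n N| <= g n) ->
  (forall n, D n N @[N --> \oo] --> (0 : R)) ->
  \sum_(0 <= n < N) D n N @[N --> \oo] --> (0 : R).
Proof.
move=> gB Dg D0.
have g0 n : 0 <= g n := le_trans (normr_ge0 _) (Dg n 0%N).
pose u N := \sum_(0 <= n < N) g n.
have uS : nondecreasing_seq u.
  by apply/nondecreasing_seqP => N; rewrite /u big_nat_recr //= lerDl.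
have cu : cvgn u.
  by apply: nondecreasing_is_cvgn => //; exists B => _ [N _ <-]; exact: gB.
have ul := nondecreasing_cvgn_le uS cu.
apply/cvgr0Pnorm_le => e e0; have e2 : 0 < e / 2 by rewrite divr_gt0.
have /cvgrPdist_le/(_ _ e2)[M _ /(_ M (leqnn M)) hM] := cu.
have HM : \sum_(0 <= n < M) D n N @[N --> \oo] --> \sum_(0 <= n < M) (0 : R).
  exact: (@cvg_finite_sum R nat _ _ (fun n N => D n N)).
rewrite big1_eq in HM; move/cvgr0Pnorm_le/(_ _ e2): HM => HM.
near=> N; have MN : (M <= N)%N by near: N; exists M.
rewrite (big_cat_nat _ (n := M)) //= (splitr e).
apply: le_trans (ler_normD _ _) _; apply: lerD; first by near: N; exact: HM.
apply: le_trans (ler_norm_sum _ _ _) _.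
apply: le_trans (_ : \sum_(M <= n < N) g n <= _); first exact: ler_sum.
have -> : \sum_(M <= n < N) g n = u N - u M.
  by rewrite /u [in RHS](big_cat_nat _ (n := M)) //= addrC addrK.
apply: le_trans hM; apply: le_trans (ler_norm _).
by rewrite lerD2r ul.
Unshelve. all: by end_near. Qed.

End Tannery.

Section SumsOverTuples.
Variable R : realType.

Lemma tuple_of_seqK r (s : seq nat) : size s = r ->
  val (insubd (nseq_tuple r 0%N) s) = s.
Proof. move=> /eqP sr; by rewrite val_insubd sr. Qed.

(** Every finite set of increasing tuples lies below some [N], so the sums over
    [chains N] exhaust the unordered sum. *)
Lemma esum_sorted_tuples r (F : seq nat -> R) (l : R) :
  (forall t : r.-tuple nat, sorted ltn t -> 0 <= F t) ->
  \sum_(s <- chains N | size s == r) F s @[N --> \oo] --> l ->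
  (\esum_(n in [set n : r.-tuple nat | sorted ltn n]) (F n)%:E = l%:E)%E.
Proof.
move=> F0 Fl.
pose tup := insubd (nseq_tuple r 0%N).
pose T N : seq (r.-tuple nat) := [seq tup s | s <- chains N & size s == r].
have uT N : uniq (T N).
  rewrite map_inj_in_uniq ?filter_uniq ?chains_uniq //.
  move=> s s'; rewrite !mem_filter => /andP[/eqP sr _] /andP[/eqP sr' _] /(congr1 val).
  by rewrite !tuple_of_seqK.
have TE N (t : r.-tuple nat) : (t \in T N) = (tval t \in chains N).
  apply/mapP/idP => [[s]|tN].
    by rewrite mem_filter => /andP[/eqP sr sN] ->; rewrite tuple_of_seqK.
  exists (tval t); first by rewrite mem_filter size_tuple eqxx.
  by apply: val_inj; rewrite tuple_of_seqK // size_tuple.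
have ST N : (\sum_(n \in [set` T N]) (F n)%:E)%E =
    (\sum_(s <- chains N | size s == r) F s)%:E.
  rewrite -fsbig_seq // big_map big_filter sumEFin.
  congr (_%:E); apply: eq_bigr => s /eqP sr.
  by rewrite tuple_of_seqK.
apply/eqP; rewrite eq_le; apply/andP; split; last first.
  have El : (\sum_(s <- chains N | size s == r) F s)%:E @[N --> \oo] --> l%:E.
    by apply: cvg_EFin; [exact: nearW | exact: Fl].
  rewrite -(cvg_lim _ El) //; apply: lime_le; first exact: cvgP El.
  near=> N; apply: esum_ge; exists [set` T N]; last by rewrite ST.
  split; first exact: finite_seq.
  by move=> t /=; rewrite TE mem_chains => /andP[].
apply: ge_ereal_sup => _ [X [finX XS] <-].
have /finite_seqP[sX XE] := finX.
pose N := (\max_(t <- sX) (last 0%N t).+1)%N.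
have XT : X `<=` [set` T N].
  move=> t Xt /=; rewrite TE mem_chains XS //=.
  apply/allP => m mt /=.
  have tN : (last 0%N t < N)%N.
    rewrite /N; apply: (@leq_bigmax_seq _ _ xpredT (fun t : r.-tuple nat => (last 0%N t).+1) t) => //.
    by move: Xt; rewrite XE.
  apply: leq_ltn_trans tN.
  have := XS _ Xt; rewrite /=; case/lastP: (tval t) mt => // s x.
  rewrite last_rcons mem_rcons inE => /predU1P[->//|ms] srt.
  have : sorted (fun m n : nat => n < m)%N (rev (rcons s x)) by rewrite rev_sorted.
  rewrite rev_rcons /= path_sortedE; last by move=> a b c /= h1 h2; apply: ltn_trans h1.
  by move=> /andP[/allP /(_ m)]; rewrite mem_rev ms => /(_ isT)/ltnW.
apply: (@le_trans _ _ (\sum_(n \in [set` T N]) (F n)%:E)%E).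
  apply: lee_fsum_nneg_subset => //; first exact: finite_seq.
    exact/subsetP.
  move=> t; rewrite !inE => /andP[_ /set_mem /=]; rewrite TE mem_chains lee_fin => /andP[st _].
  exact: F0.
rewrite ST lee_fin.
have : nondecreasing_seq (fun N => \sum_(s <- chains N | size s == r) F s).
  apply/nondecreasing_seqP => k; rewrite sum_chainsS lerDl big_seq_cond sumr_ge0 // => s /andP[sk sr].
  have : rcons s k \in chains k.+1.
    by rewrite /= mem_cat; apply/orP; right; apply/mapP; exists s.
  rewrite mem_chains => /andP[srt _].
  exact: (F0 (Tuple sr)).
move/nondecreasing_cvgn_le => /(_ (cvgP _ Fl) N).
by rewrite (cvg_lim _ Fl).
Unshelve. all: by end_near. Qed.

End SumsOverTuples.

(** * The weights and the gaps between squared nodes *)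

Fact wt_key : unit. Proof. exact: tt. Qed.

Section Main.
Variable R : realType.

Section Weights.
Implicit Types (m n p q N : nat).

Definition node n : R := n%:R + 2^-1.
(** The central binomial coefficient 'C(2 n, n) divided by 4^n. It is locked
    because [pochhammer] is a product, which rewriting with ring laws would
    otherwise expose. *)
Definition wt n : R := locked_with wt_key (pochhammer 2^-1 n / n`!%:R).

Lemma wtE n : wt n = pochhammer 2^-1 n / n`!%:R.
Proof. by rewrite /wt unlock. Qed.

Lemma node_gt0 n : 0 < node n.
Proof. by rewrite /node ltr_wpDl // ?ler0n // invr_gt0. Qed.

Lemma le_node m n : (m <= n)%N -> node m <= node n.
Proof. by move=> mn; rewrite lerD2r ler_nat. Qed.

Lemma wt0 : wt 0 = 1.
Proof. by rewrite wtE /pochhammer big_ord0 fact0 divr1. Qed.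

Lemma wtS n : wt n.+1 = wt n * node n / n.+1%:R.
Proof.
rewrite !wtE /pochhammer big_ord_recr /= factS natrM invfM /node [2^-1 + _]addrC.
have f0 : n`!%:R != 0 :> R by rewrite pnatr_eq0 -lt0n fact_gt0.
by field; rewrite f0 -mulrS pnatr_eq0.
Qed.

Lemma wt_gt0 n : 0 < wt n.
Proof.
elim: n => [|n IH]; first by rewrite wt0.
rewrite wtS; apply: divr_gt0; last by rewrite ltr0n.
by apply: mulr_gt0 => //; exact: node_gt0.
Qed.

Lemma wtS_le n : wt n.+1 <= wt n.
Proof.
rewrite wtS -mulrA ler_piMr ?(ltW (wt_gt0 n)) // ler_pdivrMr ?ltr0n // mul1r -natr1.
by rewrite lerD2l; lra.
Qed.

Lemma wt_le1 n : wt n <= 1.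
Proof. by elim: n => [|n IH]; rewrite ?wt0 // (le_trans (wtS_le n)). Qed.

(** The inductive step is (2 n + 1) (2 n + 3) <= (2 n + 2)^2. *)
Lemma wt_sqr_le n : wt n ^+ 2 * (2 * n%:R + 1) <= 1.
Proof.
elim: n => [|n IH]; first by rewrite wt0 mulr0 add0r mulr1 expr1n.
apply: le_trans IH; rewrite wtS /node -natr1.
rewrite [leLHS](_ : _ = wt n ^+ 2 * ((n%:R + 2^-1) ^+ 2 * (2 * (n%:R + 1) + 1) / (n%:R + 1) ^+ 2)); last first.
  by field; rewrite gt_eqF // ltr_wpDl.
rewrite ler_pM2l ?exprn_gt0 ?wt_gt0 //.
have n0 : 0 <= n%:R :> R by [].
have np : 0 < (n%:R + 1) ^+ 2 :> R by rewrite exprn_gt0 // ltr_wpDl.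
rewrite ler_pdivrMr // -subr_ge0 [leRHS](_ : _ = (2 * n%:R + 1) / 4); last by field.
  by rewrite divr_ge0 // addr_ge0 // mulr_ge0.
Qed.

Lemma wt_cvg0 : wt n @[n --> \oo] --> (0 : R).
Proof.
apply/cvgrPdist_lt => e e0.
have [M hM] : exists M : nat, (e ^+ 2)^-1 < M%:R.
  by exists (Num.bound (e ^+ 2)^-1); rewrite archi_boundP // invr_ge0 exprn_ge0 // ltW.
near=> n.
rewrite sub0r normrN gtr0_norm ?wt_gt0 // -(ltr_pXn2r (ltn0Sn 1)) ?nnegrE ?(ltW (wt_gt0 _)) ?(ltW e0) //.
have Mn : (M <= n)%N by near: n; exists M.
have e2 : 0 < e ^+ 2 by rewrite exprn_gt0.
have h := wt_sqr_le n.
have c : 0 < 2 * n%:R + 1 :> R by rewrite ltr_wpDl // mulr_ge0.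
rewrite -(ltr_pM2r c); apply: le_lt_trans h _.
have hMn : M%:R <= n%:R :> R by rewrite ler_nat.
rewrite -(ltr_pM2l e2) mulfV ?gt_eqF // in hM.
nra.
Unshelve. all: by end_near. Qed.

Lemma wt_node_homo m n : (m <= n)%N -> wt m * node m <= wt n * node n.
Proof.
move=> mn; rewrite -(subnKC mn); elim: (n - m)%N => [|d IH]; rewrite ?addn0 //.
apply: le_trans IH _; rewrite addnS wtS; set k := (m + d)%N.
rewrite -[leLHS]mulr1 -[leRHS]mulrA ler_pM2l ?mulr_gt0 ?wt_gt0 ?node_gt0 //.
rewrite mulrC ler_pdivlMr ?ltr0n // mul1r /node -natr1; lra.
Qed.

Lemma sqr_node_sub m n : node m ^+ 2 - node n ^+ 2 = (m%:R - n%:R) * (m%:R + n%:R + 1).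
Proof. by rewrite /node; field. Qed.

Definition inv_gap n m : R := (node m ^+ 2 - node n ^+ 2)^-1.

Lemma gap_norm_up n d : (0 < d)%N -> `|inv_gap n (n + d)| = (d%:R * (d%:R + 2 * n%:R + 1))^-1.
Proof.
move=> d0; rewrite /inv_gap sqr_node_sub natrD.
rewrite [X in `|X^-1|](_ : _ = d%:R * (d%:R + 2 * n%:R + 1)); last by ring.
by rewrite ger0_norm // invr_ge0 mulr_ge0 // !addr_ge0 // mulr_ge0.
Qed.

Lemma gap_norm_down n d : (0 < d <= n)%N ->
  `|inv_gap n (n - d)| = (d%:R * (2 * n%:R - d%:R + 1))^-1.
Proof.
move=> /andP[d0 dn]; rewrite /inv_gap sqr_node_sub natrB //.
rewrite [X in `|X^-1|](_ : _ = - (d%:R * (2 * n%:R - d%:R + 1))); last by ring.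
have dn' : d%:R <= n%:R :> R by rewrite ler_nat.
rewrite invrN normrN ger0_norm // invr_ge0 mulr_ge0 // addr_ge0 //.
have : 0 <= n%:R :> R by []. lra.
Qed.

Lemma gap_norm_le n m d : (m = n + d \/ m = n - d /\ d <= n)%N -> (0 < d)%N ->
  `|inv_gap n m| <= (d%:R * (d%:R + 1))^-1.
Proof.
move=> h d0; have d0' : 0 < d%:R :> R by rewrite ltr0n.
case: h => [->|[-> dn]].
  rewrite gap_norm_up // lef_pV2 ?posrE ?mulr_gt0 ?ltr_wpDl ?addr_ge0 ?mulr_ge0 //.
  have : 0 <= n%:R :> R by [].
  rewrite ler_pM2l //; lra.
have dn' : d%:R <= n%:R :> R by rewrite ler_nat.
have h1 : 0 < 2 * n%:R - d%:R + 1 :> R by lra.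
have h2 : 0 < d%:R + 1 :> R by lra.
rewrite gap_norm_down ?d0 // lef_pV2 ?posrE ?mulr_gt0 //.
by rewrite ler_pM2l //; lra.
Qed.

(** Multiplying by [1 + 1 / (d (d + 1))] is at most one step of the increasing
    sequence [3 d / (d + 2)], which starts at 1 and stays below 3. Products of
    such factors are therefore at most 3. *)
Lemma telescoping_factor_le (f : R) d : (0 < d)%N -> f <= (d%:R * (d%:R + 1))^-1 ->
  3 * d%:R / (d%:R + 2) * (1 + f) <= 3 * d.+1%:R / (d.+1%:R + 2).
Proof.
move=> d0 hf; have d1 : 1 <= d%:R :> R by rewrite ler1n.
have d0' : 0 < d%:R :> R by rewrite ltr0n.
apply: le_trans (_ : 3 * d%:R / (d%:R + 2) * (1 + (d%:R * (d%:R + 1))^-1) <= _).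
  by rewrite ler_wpM2l ?lerD2l // divr_ge0 ?addr_ge0 ?mulr_ge0.
rewrite -natr1 -subr_ge0.
rewrite [leRHS](_ : _ = 3 * (d%:R - 1) / ((d%:R + 2) * (d%:R + 3) * (d%:R + 1))).
  by apply: divr_ge0; [lra | rewrite !mulr_ge0 // addr_ge0].
by field; rewrite ?gt_eqF //; lra.
Qed.

Lemma prod_gap_up_le n d : (0 < d)%N ->
  \prod_(n.+1 <= m < n + d) (1 + `|inv_gap n m|) <= 3 * d%:R / (d%:R + 2).
Proof.
case: d => // d _; elim: d => [|d IH].
  by rewrite addn1 big_geq // mulr1 -natr1 addrC divff.
rewrite addnS big_nat_recr /=; last by rewrite addnS ltnS leq_addr.
apply: le_trans (telescoping_factor_le _ (@gap_norm_le n _ _ (or_introl erefl) (ltn0Sn d))) => //.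
by rewrite ler_wpM2r // addr_ge0.
Qed.

Lemma prod_gap_down_le n d : (d <= n)%N ->
  \prod_(n - d <= m < n) (1 + `|inv_gap n m|) <= 3 * d.+1%:R / (d.+1%:R + 2).
Proof.
elim: d => [|d IH] dn; first by rewrite subn0 big_geq // mulr1 -natr1 addrC divff.
rewrite big_ltn ?ltn_subrL ?(leq_trans _ dn) // subnSK // mulrC.
apply: le_trans (telescoping_factor_le _ (@gap_norm_le n _ _ (or_intror (conj erefl dn)) (ltn0Sn d))) => //.
by rewrite ler_wpM2r ?addr_ge0 // IH // ltnW.
Qed.

Lemma three_fraction_le d : 3 * d%:R / (d%:R + 2) <= 3 :> R.
Proof.
have : 0 <= d%:R :> R by [].
by move=> d0; rewrite ler_pdivrMr; lra.
Qed.

(** A discrete primitive of [d |-> (wt d)^-1 / (d * node d)], up to sign. *)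
Definition wt_primitive d : R := 2 / (d%:R * wt d).

Lemma inv_wt_telescope d : (0 < d)%N ->
  (wt d)^-1 / (d%:R * node d) = wt_primitive d - wt_primitive d.+1.
Proof.
move=> d0; have d0' : 0 < d%:R :> R by rewrite ltr0n.
rewrite /wt_primitive wtS /node -natr1.
field. rewrite !gt_eqF ?wt_gt0 //; lra.
Qed.

Lemma sum_inv_wt_le D : \sum_(1 <= d < D) (wt d)^-1 / (d%:R * node d) <= 4.
Proof.
case: D => [|D]; first by rewrite big_geq.
have -> : \sum_(1 <= d < D.+1) (wt d)^-1 / (d%:R * node d) = wt_primitive 1 - wt_primitive D.+1.
  elim: D => [|D IH]; first by rewrite big_geq // subrr.
  by rewrite big_nat_recr //= IH inv_wt_telescope // addrA subrK.
rewrite lerBlDr /wt_primitive wtS wt0 /node ler_wpDr //.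
  by rewrite divr_ge0 // mulr_ge0 // ltW // wt_gt0.
by rewrite le_eqVlt; apply/orP; left; apply/eqP; field.
Qed.

(** With [q = n + d] the denominator [d * (q + n + 1)] exceeds [d * node q], and
    [wt q * node q] increases with [q]; this reduces the sum to the telescoping
    one at [n = 0]. *)
Lemma sum_gap_wt_le n N : \sum_(n.+1 <= q < N) (wt q)^-1 * `|inv_gap n q| <= 4.
Proof.
case: (leqP N n.+1) => [Nn|nN]; first by rewrite big_geq.
rewrite -[n.+1]add1n big_addn; apply: le_trans (sum_inv_wt_le (N - n)).
rewrite !big_nat; apply: ler_sum => d /andP[d0 _].
rewrite addnC gap_norm_up //.
have d0' : 0 < d%:R :> R by rewrite ltr0n.
have n0 : 0 <= n%:R :> R by [].
rewrite -!invfM lef_pV2 ?posrE ?mulr_gt0 ?wt_gt0 ?node_gt0 ?ltr_wpDl ?addr_ge0 ?mulr_ge0 //.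
rewrite mulrCA [leRHS]mulrCA ler_pM2l //.
apply: le_trans (wt_node_homo (leq_addl n d)) _.
rewrite ler_pM2l ?wt_gt0 // /node natrD; lra.
Qed.

Lemma lower_abs_le n : lower_sum (fun m => `|inv_gap n m|) (fun=> 1) n n <= 3.
Proof.
rewrite lower_sum_one -{1}(subnn n); apply: le_trans (prod_gap_down_le (leqnn n)) _.
exact: three_fraction_le.
Qed.

Lemma upper_abs_le n N :
  upper_sum (fun m => `|inv_gap n m|) (fun q => (wt q)^-1) n N <= 13 / wt n.
Proof.
have w1 : 1 <= (wt n)^-1 by rewrite invf_ge1 ?wt_gt0 ?wt_le1.
rewrite /upper_sum (_ : 13 = 1 + 3 * 4 :> R); last by ring.
rewrite mulrDl mul1r lerD2l.
apply: le_trans (_ : 3 * \sum_(n.+1 <= q < N) (wt q)^-1 * `|inv_gap n q| <= _).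
  rewrite mulr_sumr !big_nat; apply: ler_sum => q /andP[nq _].
  rewrite mulrC ler_wpM2r ?mulr_ge0 ?invr_ge0 ?(ltW (wt_gt0 _)) //.
  rewrite -(subnKC (ltnW nq)); apply: le_trans (prod_gap_up_le _ _) (three_fraction_le _).
  by rewrite subn_gt0.
have := sum_gap_wt_le n N; lra.
Qed.

(** The domination for every exchange of limits. It is uniform in [N], and its
    growth in [n], like a square root, is absorbed by [sum_inv_node_sqr_le].
    The constant is [2 * 3 * 13]: the end factor, [lower_abs_le] and
    [upper_abs_le]. *)
Lemma sum_chains_abs_le n N : (n < N)%N ->
  \sum_(s <- chains N | n \in s) 
    (wt (head 0%N s) / wt (last 0%N s) * (1 + node (head 0%N s) / node (last 0%N s))
     * \prod_(m <- s | m != n) `|inv_gap n m|) <= 78 / wt n.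
Proof.
move=> nN.
apply: le_trans (_ : 2 * \sum_(s <- chains N | n \in s)
    (1 * (wt (last 0%N s))^-1 * \prod_(m <- s | m != n) `|inv_gap n m|) <= _).
  rewrite mulr_sumr big_seq_cond [leRHS]big_seq_cond; apply: ler_sum => s /andP[sN ns].
  rewrite mul1r mulrA ler_wpM2r ?prodr_ge0 //.
  have h : node (head 0%N s) <= node (last 0%N s).
    apply: le_node; move: sN; rewrite mem_chains => /andP[+ _].
    case: s ns => //= x s _ /(order_path_min ltn_trans)/allP h.
    by have := mem_last x s; rewrite inE => /predU1P[->//|/h/ltnW].
  rewrite mulrAC ler_wpM2r ?invr_ge0 ?(ltW (wt_gt0 _)) //.
  have h1 : node (head 0%N s) / node (last 0%N s) <= 1 by rewrite ler_pdivrMr ?node_gt0 ?mul1r.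
  have h0 : 0 <= node (head 0%N s) / node (last 0%N s) by rewrite divr_ge0 ?(ltW (node_gt0 _)).
  have := wt_le1 (head 0%N s); have := wt_gt0 (head 0%N s); nra.
rewrite (@sum_chains_through R (fun m => `|inv_gap n m|) (fun=> 1) (fun q => (wt q)^-1)) //.
have := lower_abs_le n; have := upper_abs_le n N.
set L := lower_sum _ _ _ _; set U := upper_sum _ _ _ _ => hU hL.
have U0 : 0 <= U.
  apply: addr_ge0; first by rewrite invr_ge0 ltW ?wt_gt0.
  apply: sumr_ge0 => q _; rewrite !mulr_ge0 ?invr_ge0 ?(ltW (wt_gt0 _)) //.
  by apply: prodr_ge0 => i _; rewrite addr_ge0.
have -> : 78 / wt n = 2 * (3 * (13 / wt n)) by ring.
nra.
Qed.

Lemma sum_inv_node_sqr_le N : \sum_(0 <= n < N) (node n ^+ 2 * wt n)^-1 <= 8.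
Proof.
case: N => [|N]; first by rewrite big_geq.
rewrite big_ltn // wt0 /node add0r mulr1 (_ : 8 = 4 + 4 :> R); last by ring.
apply: lerD; first by rewrite le_eqVlt; apply/orP; left; apply/eqP; field.
apply: le_trans (sum_inv_wt_le N.+1).
rewrite !big_nat; apply: ler_sum => d /andP[d0 _].
have d0' : 0 < d%:R :> R by rewrite ltr0n.
rewrite -invfM lef_pV2 ?posrE ?mulr_gt0 ?exprn_gt0 ?wt_gt0 ?node_gt0 //.
rewrite mulrC ler_pM2r ?wt_gt0 // expr2 ler_pM2r ?node_gt0 // /node; lra.
Qed.

End Weights.

(** * Contiguity relations *)

Section Contiguity.
Variable v : R.
Implicit Types (m n p q N : nat).

(** [fact_ratio n p] and the factorials in [upper_series] are the products of
    the gaps [node m ^+ 2 - node n ^+ 2] up to sign and constants. *)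
Definition fact_ratio n p : R := (n + p)`!%:R / (n - p)`!%:R.

Definition shift m : R := node m ^+ 2 - v.

(** Up to a constant, a terminating hypergeometric series 3F2(-n, n + 1, c; ...)
    at 1: a polynomial in [v], read off from the chains below [n]. The series
    [upper_series], read off from the chains above [n], is of the same kind
    but truncated at [N]. *)
Definition lower_series (f : nat -> R) n :=
  \sum_(0 <= p < n.+1) (-1) ^+ p * fact_ratio n p * f p * \prod_(p.+1 <= m < n.+1) shift m.

Definition upper_series (f : nat -> R) n N :=
  \sum_(n <= q < N) \prod_(n <= m < q) shift m / ((q - n)`!%:R * (q + n).+1`!%:R * f q).

Definition wt_node n := wt n * node n.

Lemma fact_neq0 n : n`!%:R != 0 :> R.
Proof. by rewrite pnatr_eq0 -lt0n fact_gt0. Qed.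

Lemma fact_ratioSn n p : (p <= n)%N ->
  fact_ratio n.+1 p = fact_ratio n p * (n%:R + 1 + p%:R) / (n%:R + 1 - p%:R).
Proof.
move=> pn; rewrite /fact_ratio addSn subSn // !factS !natrM -!natr1 natrD natrB //.
have h := fact_neq0 (n - p); have pn' : p%:R <= n%:R :> R by rewrite ler_nat.
by field; rewrite h /= gt_eqF //; lra.
Qed.

Lemma fact_ratioSp n p : (p < n)%N ->
  fact_ratio n p.+1 = fact_ratio n p * (n%:R + 1 + p%:R) * (n%:R - p%:R).
Proof.
move=> pn; rewrite /fact_ratio addnS -[in (n - p)%N](subnSK pn) !factS !natrM subnSK // natrB ?(ltnW pn) //.
rewrite -[(n + p).+1%:R]natr1 natrD.
have h := fact_neq0 (n - p.+1); have pn' : p%:R < n%:R :> R by rewrite ltr_nat.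
by field; rewrite h /= gt_eqF //; lra.
Qed.

Lemma fact_ratio0 n : fact_ratio n 0 = 1.
Proof. by rewrite /fact_ratio addn0 subn0 divff // fact_neq0. Qed.

Lemma fact_ratio_diagS n : fact_ratio n.+1 n.+1 = fact_ratio n n * (2 * n%:R + 1) * (2 * n%:R + 2).
Proof.
rewrite /fact_ratio !subnn fact0 !divr1 addSn addnS !factS !natrM -!natr1 natrD; ring.
Qed.

(** Creative telescoping in [p]: the summand of the contiguity relation between
    [n] and [n + 1] is a difference, and the right-hand side is its closed
    partial sum. The next lemma treats the second series, with the same
    certificate up to a factor. *)
Lemma lower_telescope1 n p : (p <= n)%N ->
  \sum_(0 <= i < p.+1) (-1) ^+ i * wt i * \prod_(i.+1 <= m < n.+1) shift m *
     (fact_ratio n.+1 i * shift n.+1 - (shift n.+1 - node n.+1 + node i) * fact_ratio n i) =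
  2 * (-1) ^+ p * fact_ratio n p * wt p * (\prod_(p.+1 <= m < n.+1) shift m) *
   (n%:R + 1 + p%:R) * node p.
Proof.
elim: p => [|p IH] pn.
  by rewrite big_nat1 !fact_ratio0 wt0 /shift /node -natr1; field.
rewrite big_nat_recr //= IH ?(ltnW pn) //.
rewrite [\prod_(p.+1 <= m < n.+1) _]big_ltn //; set Q := \prod_(_ <= m < _) _.
rewrite (fact_ratioSn pn) (fact_ratioSp pn) wtS exprS /shift /node -!natr1.
have pn' : p%:R < n%:R :> R by rewrite ltr_nat.
have p0 : 0 <= p%:R :> R by [].
by field; rewrite !gt_eqF //; lra.
Qed.

Lemma lower_telescope2 n p : (p <= n)%N ->
  \sum_(0 <= i < p.+1) (-1) ^+ i * wt i * \prod_(i.+1 <= m < n.+1) shift m *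
     (fact_ratio n.+1 i * node i * shift n.+1 -
        ((node n.+1 - shift n.+1) * node i - v) * fact_ratio n i) =
  (2 * n%:R + 3) * (-1) ^+ p * fact_ratio n p * wt p * (\prod_(p.+1 <= m < n.+1) shift m) *
   (n%:R + 1 + p%:R) * node p.
Proof.
elim: p => [|p IH] pn.
  by rewrite big_nat1 !fact_ratio0 wt0 /shift /node -natr1; field.
rewrite big_nat_recr //= IH ?(ltnW pn) //.
rewrite [\prod_(p.+1 <= m < n.+1) _]big_ltn //; set Q := \prod_(_ <= m < _) _.
rewrite (fact_ratioSn pn) (fact_ratioSp pn) wtS exprS /shift /node -!natr1.
have pn' : p%:R < n%:R :> R by rewrite ltr_nat.
have p0 : 0 <= p%:R :> R by [].
by field; rewrite !gt_eqF //; lra.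
Qed.

Lemma lower_recr f n : lower_series f n.+1 =
  \sum_(0 <= p < n.+1) (-1) ^+ p * \prod_(p.+1 <= m < n.+1) shift m *
     (fact_ratio n.+1 p * f p * shift n.+1) +
  (-1) ^+ n.+1 * fact_ratio n.+1 n.+1 * f n.+1.
Proof.
rewrite /lower_series big_nat_recr //= [X in _ * X]big_geq // mulr1; congr (_ + _).
rewrite !big_nat; apply: eq_bigr => p /andP[_ pn].
by rewrite big_nat_recr //=; ring.
Qed.

(** What [lower_telescope1] leaves at [p = n] cancels the extra term
    [p = n + 1] of the longer series. *)
Lemma lowerS1 n : lower_series wt n.+1 =
  (shift n.+1 - node n.+1) * lower_series wt n + lower_series wt_node n.
Proof.
have := lower_telescope1 (leqnn n).
rewrite [\prod_(n.+1 <= m < n.+1) _]big_geq // mulr1 => h.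
rewrite lower_recr.
transitivity ((shift n.+1 - node n.+1) * lower_series wt n + lower_series wt_node n
   + (2 * (-1) ^+ n * fact_ratio n n * wt n * (n%:R + 1 + n%:R) * node n)
   + (-1) ^+ n.+1 * fact_ratio n.+1 n.+1 * wt n.+1).
  congr (_ + _); rewrite -h /lower_series mulr_sumr -!big_split /=.
  by apply: eq_bigr => p _; rewrite /wt_node; ring.
rewrite fact_ratio_diagS wtS exprS -natr1 /node; field.
have n0 : 0 <= n%:R :> R by [].
by rewrite gt_eqF //; lra.
Qed.

Lemma lowerS2 n : lower_series wt_node n.+1 =
  (node n.+1 - shift n.+1) * lower_series wt_node n - v * lower_series wt n.
Proof.
have := lower_telescope2 (leqnn n).
rewrite [\prod_(n.+1 <= m < n.+1) _]big_geq // mulr1 => h.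
rewrite lower_recr.
transitivity ((node n.+1 - shift n.+1) * lower_series wt_node n - v * lower_series wt n
   + ((2 * n%:R + 3) * (-1) ^+ n * fact_ratio n n * wt n * (n%:R + 1 + n%:R) * node n)
   + (-1) ^+ n.+1 * fact_ratio n.+1 n.+1 * wt_node n.+1).
  congr (_ + _); rewrite -h /lower_series -mulNr !mulr_sumr -!big_split /=.
  by apply: eq_bigr => p _; rewrite /wt_node; ring.
rewrite /wt_node fact_ratio_diagS wtS exprS -natr1 /node -natr1; field.
have n0 : 0 <= n%:R :> R by [].
by rewrite gt_eqF //; lra.
Qed.

Lemma upper_recr f n N : (n <= N)%N -> upper_series f n N.+1 = upper_series f n N +
  \prod_(n <= m < N) shift m / ((N - n)`!%:R * (N + n).+1`!%:R * f N).
Proof. by move=> nN; rewrite /upper_series big_nat_recr. Qed.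

(** The value at [N] of the telescoping certificate of the upper series, up to a
    constant. *)
Definition upper_boundary n N :=
  \prod_(n.+1 <= m < N) shift m / ((N - n.+1)`!%:R * (N + n.+1)`!%:R * wt N).

(** The matrix here is the transpose of the one in [lowerS1] and [lowerS2], which
    makes the pairing of the two pairs of series independent of [n], up to the
    boundary term. *)
Lemma upper_telescope n N : (n < N)%N ->
  upper_series wt n N = (shift n.+1 - node n.+1) * upper_series wt n.+1 N
    - v * upper_series wt_node n.+1 N
    + (2 * n%:R + 1) * upper_boundary n N /\
  upper_series wt_node n N = upper_series wt n.+1 N
    + (node n.+1 - shift n.+1) * upper_series wt_node n.+1 N
    + 2 * upper_boundary n N.
Proof.
move=> /subnKC <-; elim: (N - n.+1)%N => [|d [IH1 IH2]].
  rewrite addn0 /upper_boundary /upper_series !big_nat1 !big_geq // !subnn fact0.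
  have h := fact_neq0 (n + n).+1; have w := wt_gt0 n; have n0 : 0 <= n%:R :> R by [].
  rewrite addSn addnS [(n + n).+2`!]factS natrM -[(n + n).+2%:R]natr1 -[(n + n).+1%:R]natr1 natrD.
  rewrite /wt_node wtS -[n.+1%:R]natr1 /node.
  by split; field; rewrite h /= !gt_eqF //; lra.
rewrite addnS; set N1 := (n.+1 + d)%N in IH1 IH2 *.
have nN : (n < N1)%N by rewrite /N1 ltnS leq_addr.
have Nn : (N1 - n = d.+1)%N by rewrite /N1 addSnnS addKn.
have -> : upper_boundary n N1.+1 = \prod_(n.+1 <= m < N1) shift m * shift N1 /
   (d.+1`!%:R * (N1 + n.+2)`!%:R * wt N1.+1).
  by rewrite /upper_boundary big_nat_recr //= subSS addSnnS Nn.
rewrite ![upper_series _ _ N1.+1]upper_recr ?(ltnW nN) // {}IH1 {}IH2.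
rewrite /upper_boundary [\prod_(n <= m < N1) _]big_ltn //.
set P := \prod_(n.+1 <= m < N1) shift m.
have -> : (N1 - n.+1 = d)%N by rewrite /N1 addKn.
rewrite Nn.
have NR : N1%:R = n%:R + 1 + d%:R :> R by rewrite /N1 natrD -natr1.
have -> : (N1 + n.+2 = (N1 + n).+2)%N by rewrite !addnS.
have -> : (N1 + n.+1 = (N1 + n).+1)%N by rewrite addnS.
have -> : (N1 + n).+2`!%:R = (N1%:R + n%:R + 2) * (N1 + n).+1`!%:R :> R.
  by rewrite [(N1 + n).+2`!]factS natrM -natrD -!natr1; congr (_ * _); ring.
have -> : d.+1`!%:R = (d%:R + 1) * d`!%:R :> R by rewrite factS natrM natr1.
rewrite /wt_node wtS /shift -[N1.+1%:R]natr1 /node -[n.+1%:R]natr1 NR.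
have h := fact_neq0 d; have h' := fact_neq0 (N1 + n).+1; have w := wt_gt0 N1.
have n0 : 0 <= n%:R :> R by []; have d0 : 0 <= d%:R :> R by [].
by split; field; rewrite h h' /= !gt_eqF //; lra.
Qed.

Hypothesis v_ge0 : 0 <= v.

Lemma wt_factS N : wt N.+1 * N.+1`!%:R = wt N * N`!%:R * node N.
Proof.
rewrite wtS factS natrM; field.
by rewrite -mulrS pnatr_eq0.
Qed.

Lemma wt_fact_gt0 N : 0 < wt N * N`!%:R.
Proof. by rewrite mulr_gt0 ?wt_gt0 // ltr0n fact_gt0. Qed.

(** As soon as [node m ^+ 2 >= v], a factor [`|shift m|] is at most
    [node m ^+ 2], and the product of these squares over [m < N] is
    [(wt N * N`!) ^+ 2]. *)
Lemma prod_shift_le n : exists2 C : R, 0 <= C &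
  forall N, `|\prod_(n <= m < N) shift m| <= C * (wt N * N`!%:R) ^+ 2.
Proof.
pose D N : R := `|\prod_(n <= m < N) shift m| / (wt N * N`!%:R) ^+ 2.
pose K := maxn n (Num.bound v).
have D0 N : 0 <= D N by rewrite divr_ge0 ?exprn_ge0 ?(ltW (wt_fact_gt0 N)).
have DS N : (K <= N)%N -> D N.+1 <= D N.
  rewrite geq_max => /andP[nN vN].
  rewrite /D big_nat_recr //= normrM wt_factS exprMn invfM mulrACA ler_piMr ?D0 //.
  have vN' : v < N%:R.
    by apply: lt_le_trans (archi_boundP v_ge0) _; rewrite ler_nat.
  have a0 : 0 < node N ^+ 2 by rewrite exprn_gt0 ?node_gt0.
  rewrite ler_pdivrMr // mul1r /shift ler_norml.
  have : N%:R <= node N ^+ 2.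
    rewrite -subr_ge0 (_ : _ - _ = N%:R ^+ 2 + 4^-1); last by rewrite /node; field.
    by rewrite addr_ge0 // exprn_ge0.
  move=> /(lt_le_trans vN') va; apply/andP; split; last by rewrite gerBl.
  by rewrite (le_trans (_ : _ <= 0)) ?oppr_le0 ?(ltW a0) // subr_ge0 ltW.
(* [D] decreases from [K] on, and the sum bounds its earlier values. *)
exists (\sum_(0 <= i < K.+1) D i) => [|N]; first exact: sumr_ge0.
rewrite -ler_pdivrMr ?exprn_gt0 ?wt_fact_gt0 // -/(D N).
have DK : forall i, (i <= K)%N -> D i <= \sum_(0 <= i < K.+1) D i.
  move=> i iK; rewrite (bigD1_seq i) ?mem_index_iota ?iota_uniq //=.
  by rewrite lerDl sumr_ge0.
have [/DK//|/ltnW KN] := leqP N K.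
apply: le_trans (DK _ (leqnn K)); rewrite -(subnKC KN).
elim: (N - K)%N => [|d IH]; rewrite ?addn0 // addnS.
by apply: le_trans IH; rewrite DS // leq_addr.
Qed.

(** The step from [k] to [k + 1] replaces the factor [N - k] by the larger
    [N + k + 1]. *)
Lemma fact_sqr_le N k : (k <= N)%N -> (N`! * N`! <= (N - k)`! * (N + k)`!)%N.
Proof.
elim: k => [|k IH] kN; first by rewrite subn0 addn0.
apply: leq_trans (IH (ltnW kN)) _.
rewrite -(subnSK kN) addnS !factS -mulnA [leqRHS]mulnCA leq_mul2r.
by rewrite subnSK // (leq_trans (leq_subr _ _)) ?orbT // -addnS leq_addr.
Qed.

(** By [prod_shift_le] and [fact_sqr_le] the boundary term is
    [O(wt N)]. *)
Lemma upper_boundary_cvg0 n : upper_boundary n N @[N --> \oo] --> (0 : R).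
Proof.
have [C C0 hC] := prod_shift_le n.+1.
apply/cvgr0Pnorm_le => e e0.
have h : C * wt N @[N --> \oo] --> C * 0 by apply: cvg_cstM; exact: wt_cvg0.
rewrite mulr0 in h; move/cvgr0Pnorm_le/(_ e e0): h => h.
near=> N; have nN : (n.+1 <= N)%N by near: N; exists n.+1.
apply: le_trans (_ : C * wt N <= _); last first.
  apply: le_trans (ler_norm _) _; near: N; exact: h.
have w0 := wt_gt0 N.
have f0 : 0 < (N - n.+1)`!%:R * (N + n.+1)`!%:R :> R by rewrite mulr_gt0 // ltr0n fact_gt0.
rewrite /upper_boundary normrM [X in _ * X]gtr0_norm ?invr_gt0 ?mulr_gt0 //.
rewrite ler_pdivrMr ?mulr_gt0 //; apply: le_trans (hC N) _.
have key : N`!%:R * N`!%:R <= (N - n.+1)`!%:R * (N + n.+1)`!%:R :> R.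
  by rewrite -!natrM ler_nat fact_sqr_le.
rewrite [leLHS](_ : _ = C * wt N ^+ 2 * (N`!%:R * N`!%:R)); last by ring.
rewrite [leRHS](_ : _ = C * wt N ^+ 2 * ((N - n.+1)`!%:R * (N + n.+1)`!%:R)); last by ring.
by rewrite ler_wpM2l // mulr_ge0 // exprn_ge0 // ltW.
Unshelve. all: by end_near. Qed.

Definition pairing n N := lower_series wt n * upper_series wt n N
  + lower_series wt_node n * upper_series wt_node n N.

Lemma pairingS n N : (n < N)%N ->
  pairing n N = pairing n.+1 N
    + ((2 * n%:R + 1) * lower_series wt n + 2 * lower_series wt_node n) * upper_boundary n N.
Proof.
move=> nN; rewrite /pairing lowerS1 lowerS2.
by have [-> ->] := upper_telescope nN; ring.
Qed.

Lemma pairing_cvg n l : pairing 0 N @[N --> \oo] --> (l : R) ->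
  pairing n N @[N --> \oo] --> (l : R).
Proof.
move=> h0; elim: n => // n IH.
have h : ((2 * n%:R + 1) * lower_series wt n + 2 * lower_series wt_node n) * upper_boundary n N @[N --> \oo] -->
   ((2 * n%:R + 1) * lower_series wt n + 2 * lower_series wt_node n) * (0 : R).
  by apply: cvg_cstM; exact: upper_boundary_cvg0.
rewrite mulr0 in h.
have H := cvgB IH h; rewrite subr0 in H; apply: cvg_near_eq (H _).
near=> N; have nN : (n < N)%N by near: N; exists n.+1.
by rewrite fctE (pairingS nN) addrK.
Unshelve. all: by end_near. Qed.

(** With [v = b ^+ 2], twice the general term of the Gauss series
    2F1(1/2 - b, 1/2 + b; 3/2; 1). *)
Definition gauss_term q : R :=
  \prod_(0 <= m < q) shift m / ((q`!%:R ^+ 2) * wt q * node q).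

Lemma pairing0 N : pairing 0 N = \sum_(0 <= q < N) gauss_term q.
Proof.
rewrite /pairing /lower_series !big_nat1 !fact_ratio0 expr0 big_geq // /wt_node wt0.
rewrite /upper_series !mulr1 !mul1r mulr_sumr -big_split /=.
apply: eq_bigr => q _; rewrite subn0 addn0 /gauss_term factS natrM /node -natr1.
have q0 : 0 <= q%:R :> R by []; have w := wt_gt0 q; have f := fact_neq0 q.
by field; rewrite f /= !gt_eqF //; lra.
Qed.

Lemma gauss_termS q :
  gauss_term q.+1 * ((2 * q%:R + 3) * (2 * q%:R + 2)) = 4 * gauss_term q * shift q.
Proof.
rewrite /gauss_term big_nat_recr //= wtS factS natrM /node -natr1.
have q0 : 0 <= q%:R :> R by []; have w := wt_gt0 q; have f := fact_neq0 q.
by field; rewrite f /= !gt_eqF //; lra.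
Qed.

(** The factor [2 q + 1] cancels [node q], so that [prod_shift_le] leaves
    [O(wt q)]. *)
Lemma gauss_term_cvg0 : (2 * q%:R + 1) * gauss_term q @[q --> \oo] --> (0 : R).
Proof.
have [C C0 hC] := prod_shift_le 0.
have h : 2 * C * wt N @[N --> \oo] --> 2 * C * 0 by apply: cvg_cstM; exact: wt_cvg0.
rewrite mulr0 in h.
apply/cvgr0Pnorm_le => e e0; move/cvgr0Pnorm_le/(_ e e0): h => h.
near=> N; apply: le_trans (_ : 2 * C * wt N <= _); last first.
  apply: le_trans (ler_norm _) _; near: N; exact: h.
have -> : (2 * N%:R + 1) * gauss_term N =
   2 * (\prod_(0 <= m < N) shift m / (N`!%:R ^+ 2 * wt N)).
  rewrite /gauss_term /node.
  have q0 : 0 <= N%:R :> R by []; have w := wt_gt0 N; have f := fact_neq0 N.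
  by field; rewrite f /= !gt_eqF //; lra.
have f0 : 0 < N`!%:R ^+ 2 * wt N by rewrite mulr_gt0 ?wt_gt0 // exprn_gt0 // ltr0n fact_gt0.
rewrite normrM ger0_norm // -mulrA ler_pM2l // normrM [X in _ * X]gtr0_norm ?invr_gt0 //.
rewrite ler_pdivrMr //; apply: le_trans (hC N) _.
by rewrite le_eqVlt; apply/orP; left; apply/eqP; ring.
Unshelve. all: by end_near. Qed.

End Contiguity.

(** * A case of Gauss's summation theorem *)

Section GaussSum.
Variable b : R.
Hypothesis b_gt0 : 0 < b.
Local Notation c := (gauss_term (b ^+ 2)).

Let arg (t : R) : R := 2 * b * (pi / 2 - t).

Let is_derive_arg (t : R) : is_derive t 1 arg (- (2 * b)).
Proof.
rewrite (_ : arg = fun u => 2 * b * (pi / 2 + (-1) * u)); last first.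
  by apply/funext => u; rewrite /arg mulN1r.
apply: (is_derive_eq (is_derive_scale (2 * b)
  (is_derive_add (is_derive_cst (pi / 2 : R) t 1) (is_derive_scale (-1) (is_derive_id t 1))))).
by ring.
Qed.

(** The Wronskian of [sin ^+ (2 q + 1)] and of [t |-> sin (arg t)], a solution
    of g'' = - 4 b^2 g that vanishes at [pi / 2]. The series of the
    [c q * sin ^+ (2 q + 1)] formally solves the same equation, so the
    combination [vsum] of these Wronskians is nearly constant. *)
Let vterm q (t : R) : R :=
  (2 * q%:R + 1) * (sin t ^+ (2 * q) * (cos t * sin (arg t)))
  + 2 * b * (sin t ^+ (2 * q).+1 * cos (arg t)).

Let is_derive_vterm q (t : R) : is_derive t 1 (vterm q)
  ((2 * q%:R + 1) * (2 * q)%:R * sin t ^+ (2 * q).-1 * sin (arg t)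
   - ((2 * q%:R + 1) ^+ 2 - 4 * b ^+ 2) * sin t ^+ (2 * q).+1 * sin (arg t)).
Proof.
have ds : is_derive t 1 (fun u => sin (arg u)) (cos (arg t) * - (2 * b)).
  exact: (@is_derive1_comp _ _ _ _ _ _ (is_derive_sin _) (is_derive_arg t)).
have dc : is_derive t 1 (fun u => cos (arg u)) (- sin (arg t) * - (2 * b)).
  exact: (@is_derive1_comp _ _ _ _ _ _ (is_derive_cos _) (is_derive_arg t)).
apply: (is_derive_eq (is_derive_add
  (is_derive_scale (2 * q%:R + 1) (is_derive_mul (is_derive_pow (2 * q) (is_derive_sin t))
     (is_derive_mul (is_derive_cos t) ds)))
  (is_derive_scale (2 * b) (is_derive_mul (is_derive_pow (2 * q).+1 (is_derive_sin t)) dc)))).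
have e : (2 * q)%:R * sin t ^+ (2 * q).-1 * sin t ^+ 2 = 2 * q%:R * sin t ^+ (2 * q).+1.
  case: (q) => [|p]; first by rewrite muln0 !mul0r mulr0 mul0r.
  by rewrite -mulrA -exprD natrM mulnS /= addn2.
have cs : cos t ^+ 2 = 1 - sin t ^+ 2 by rewrite -(cos2Dsin2 t) addrK.
rewrite /= -natr1 natrM.
rewrite natrM in e.
transitivity ((2 * q%:R + 1) * (2 * q%:R * sin t ^+ (2 * q).-1) * cos t ^+ 2 * sin (arg t)
   - (2 * q%:R + 1) * sin t ^+ (2 * q).+1 * sin (arg t) 
   + 4 * b ^+ 2 * sin t ^+ (2 * q).+1 * sin (arg t)); first by rewrite exprS; ring.
rewrite cs mulrBr mulr1 -[X in _ - X]mulrA.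
transitivity ((2 * q%:R + 1) * (2 * q%:R * sin t ^+ (2 * q).-1) * sin (arg t)
   - (2 * q%:R + 1) * (2 * q%:R * sin t ^+ (2 * q).-1 * sin t ^+ 2) * sin (arg t)
   - (2 * q%:R + 1) * sin t ^+ (2 * q).+1 * sin (arg t)
   + 4 * b ^+ 2 * sin t ^+ (2 * q).+1 * sin (arg t)); first by ring.
rewrite e; ring.
Qed.

Let vsum Q (t : R) : R := \sum_(0 <= q < Q) c q * vterm q t.

(** The recurrence of the [c q] makes the derivative telescope to a single
    term. *)
Let is_derive_vsum Q (t : R) : is_derive t 1 (vsum Q)
  (- ((2 * Q%:R + 1) * c Q * ((2 * Q)%:R * sin t ^+ (2 * Q).-1) * sin (arg t))).
Proof.
elim: Q => [|Q IH].
  rewrite muln0 mul0r mulr0 mul0r oppr0 (_ : vsum 0 = cst 0); first exact: is_derive_cst.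
  by apply/funext => u; rewrite /vsum big_geq.
rewrite (_ : vsum Q.+1 = fun u => vsum Q u + c Q * vterm Q u); last first.
  by apply/funext => u; rewrite /vsum big_nat_recr.
apply: (is_derive_eq (is_derive_add IH (is_derive_scale (c Q) (is_derive_vterm Q t)))).
have h := gauss_termS (b ^+ 2) Q.
transitivity (- (c Q.+1 * ((2 * Q%:R + 3) * (2 * Q%:R + 2))) * sin t ^+ (2 * Q).+1 * sin (arg t)).
  by rewrite h /shift /node; field.
by rewrite mulnS /= natrD natrM -natr1; ring.
Qed.

Let vsum_pihalf Q : vsum Q (pi / 2) = 2 * b * \sum_(0 <= q < Q) c q.
Proof.
rewrite /vsum mulr_sumr; apply: eq_bigr => q _; rewrite /vterm /arg subrr mulr0.
by rewrite sin_pihalf cos_pihalf sin0 cos0 !expr1n; ring.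
Qed.

Let vsum0 Q : vsum Q.+1 0 = 2 * sin (pi * b).
Proof.
rewrite /vsum big_ltn // big_add1 /= big1 ?addr0.
  rewrite /vterm /arg sin0 cos0 muln0 expr0 expr1 mul0r mulr0 addr0 subr0.
  rewrite /gauss_term big_geq // fact0 wt0 /node.
  have -> : 2 * b * (pi / 2) = pi * b by field.
  by field.
by move=> q _; rewrite /vterm sin0 !expr0n mulnS /= !(mul0r, mulr0, addr0).
Qed.

(** The values of [vsum] at [pi / 2] and at 0 are [2 * b] times the partial sum
    and [2 * sin (pi * b)]. Their difference is the integral of a derivative
    which, because [`|sin (arg t)|] is at most [4 * b * cos t], is dominated
    by that of [K Q * sin t ^+ (2 * Q)], and [K Q] tends to 0. *)
Lemma sum_gauss_cvg :
  \sum_(0 <= q < N) c q @[N --> \oo] --> sin (pi * b) / b.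
Proof.
pose K Q : R := (2 * Q%:R + 1) * `|c Q| * (4 * b).
have bound Q : `|vsum Q (pi / 2) - vsum Q 0| <= K Q.
  pose G t := K Q * sin t ^+ (2 * Q).
  have pi0 : 0 < pi :> R := pi_gt0 R.
  have K0 : 0 <= K Q by rewrite !mulr_ge0 ?addr_ge0 ?mulr_ge0 // ltW.
  have dG (t : R) : is_derive t 1 G (K Q * ((2 * Q)%:R * sin t ^+ (2 * Q).-1 * cos t)).
    exact: (is_derive_scale (K Q) (is_derive_pow (2 * Q) (is_derive_sin t))).
  have ph : 0 <= pi / 2 :> R by rewrite divr_ge0 // ltW.
  apply: le_trans (derive_norm_le ph (is_derive_vsum Q) dG _) _.
    move=> t /andP[t0 t1].
    have s0 : 0 <= sin t by rewrite sin_ge0_pi //; apply/andP; split; lra.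
    have hc : `|sin (arg t)| <= 4 * b * cos t.
      have z : 0 <= pi / 2 - t <= pi / 2 by apply/andP; split; lra.
      have := half_le_sin z; rewrite sinB sin_pihalf cos_pihalf mul1r mul0r subr0 => hz.
      apply: le_trans (_ : 2 * b * (pi / 2 - t) <= _); last first.
        by rewrite (_ : 4 * b * cos t = 2 * b * (2 * cos t)); [rewrite ler_wpM2l // mulr_ge0 // ltW | ring].
      have a0 : 0 <= arg t by rewrite /arg !mulr_ge0 ?(ltW b_gt0) //; case/andP: z.
      exact: sin_norm_le.
    rewrite /K; move: (c Q) => C; rewrite normrN !normrM (ger0_norm (_ : 0 <= 2 * Q%:R + 1)) ?addr_ge0 ?mulr_ge0 //.
    rewrite [`|_%:R|]ger0_norm // [`|_ ^+ _|]ger0_norm ?exprn_ge0 //.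
    rewrite [leRHS](_ : _ = (2 * Q%:R + 1) * `|C| * ((2 * Q)%:R * sin t ^+ (2 * Q).-1) * (4 * b * cos t)); last by ring.
    by rewrite ler_wpM2l // !mulr_ge0 ?addr_ge0 ?mulr_ge0 ?exprn_ge0.
  rewrite /G sin_pihalf expr1n mulr1 sin0 gerBl mulr_ge0 // exprn_ge0 //.
have K0 : K Q @[Q --> \oo] --> (0 : R).
  have h := gauss_term_cvg0 (ltW (exprn_gt0 2 b_gt0)).
  have H := @cvg_cstM R (4 * b) _ _ (cvg_norm h); rewrite normr0 mulr0 in H.
  apply: cvg_near_eq (H _); near=> Q.
  by rewrite /K normrM mulrC ger0_norm // addr_ge0 // mulr_ge0.
have b2 : 0 < 2 * b by rewrite mulr_gt0.
apply/cvgrPdist_le => e e0.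
move/cvgr0Pnorm_le : K0 => /(_ (e * (2 * b))); rewrite mulr_gt0 // => /(_ isT) K0.
near=> Q; have Q0 : (0 < Q)%N by near: Q; exists 1%N.
rewrite -(ler_pM2r b2); apply: le_trans (_ : K Q <= _); last first.
  by apply: le_trans (ler_norm _) _; near: Q; exact: K0.
apply: le_trans (bound Q); rewrite vsum_pihalf -(prednK Q0) vsum0 distrC.
rewrite -[X in _ * X](ger0_norm (ltW b2)) -normrM le_eqVlt; apply/orP; left; apply/eqP.
by congr (`|_|); field; rewrite gt_eqF.
Unshelve. all: by end_near. Qed.
End GaussSum.

(** * Taylor coefficients of the sine kernel *)

Section SineTaylor.
Implicit Types (A : R) (m n s j M : nat).

(** The coefficient of v^m in sin(pi sqrt v) / sqrt v. *)
Definition sine_coef m : R := (-1) ^+ m * pi ^+ m.*2.+1 / m.*2.+1`!%:R.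

Lemma sine_coefS m : sine_coef m.+1 * ((2 * m%:R + 2) * (2 * m%:R + 3)) = - pi ^+ 2 * sine_coef m.
Proof.
rewrite /sine_coef doubleS !factS !natrM !exprS -!natr1 -muln2 natrM.
have h : (m * 2)`!%:R != 0 :> R by exact: fact_neq0.
have m0 : 0 <= m%:R :> R by [].
by field; rewrite h /= !gt_eqF //; lra.
Qed.

(** Partial sums of A^s times the s-th Taylor coefficient at A of
    sin(pi sqrt v) / sqrt v. *)
Definition taylor_sum A s M := \sum_(0 <= m < M) sine_coef m * 'C(m, s)%:R * A ^+ m.

Lemma bin_step (m s : nat) :
  (s%:R + 2) * 'C(m.+1, s.+2)%:R = (m%:R - s%:R) * 'C(m.+1, s.+1)%:R :> R.
Proof.
have [ms|sm] := leqP s m.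
  by rewrite -natrB // -(natrD _ s 2) addn2 -!natrM mul_bin_left subSS.
rewrite (@bin_small m.+1 s.+2) ?ltnS ?(leqW sm) //; last by rewrite ltnW.
by rewrite bin_small ?ltnS // !mulr0.
Qed.

(** The function f(v) = sin(pi sqrt v) / sqrt v satisfies
    4 v f'' + 6 f' + pi^2 f = 0; this is the equation differentiated s times,
    at the level of partial sums. *)
Lemma taylor_sum_rec A s M :
  4 * (s%:R + 2) * (s%:R + 1) * taylor_sum A s.+2 M.+1 =
  - ((4 * s%:R + 6) * (s%:R + 1) * taylor_sum A s.+1 M.+1)
  - pi ^+ 2 * A * taylor_sum A s M.
Proof.
elim: M => [|M IH].
  rewrite /taylor_sum !big_nat1 !big_geq // !bin_small //; ring.
have rec t N : taylor_sum A t N.+1 = taylor_sum A t N + sine_coef N * 'C(N, t)%:R * A ^+ N.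
  by rewrite /taylor_sum big_nat_recr.
rewrite ![taylor_sum A _ M.+2]rec [taylor_sum A s M.+1]rec [LHS]mulrDr IH.
have b1 := bin_step M s.
have b2 : (s%:R + 1) * 'C(M.+1, s.+1)%:R = (M%:R + 1) * 'C(M, s)%:R :> R.
  by rewrite natr1 natr1 -!natrM -mul_bin_diag.
have k := sine_coefS M.
rewrite [A ^+ M.+1]exprS.
transitivity (- ((4 * s%:R + 6) * (s%:R + 1) * taylor_sum A s.+1 M.+1)
   - pi ^+ 2 * A * taylor_sum A s M
   + 4 * (s%:R + 1) * ((s%:R + 2) * 'C(M.+1, s.+2)%:R) * sine_coef M.+1 * (A * A ^+ M)); first by ring.
rewrite b1.
transitivity (- ((4 * s%:R + 6) * (s%:R + 1) * taylor_sum A s.+1 M.+1)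
   - pi ^+ 2 * A * taylor_sum A s M
   - (4 * s%:R + 6) * ((s%:R + 1) * 'C(M.+1, s.+1)%:R) * sine_coef M.+1 * (A * A ^+ M)
   + (sine_coef M.+1 * ((2 * M%:R + 2) * (2 * M%:R + 3))) * ((s%:R + 1) * 'C(M.+1, s.+1)%:R) / (M%:R + 1) * (A * A ^+ M)).
  by field; rewrite gt_eqF // ltr_wpDl.
rewrite k (_ : _ * (_ * _) / (M%:R + 1) = - pi ^+ 2 * sine_coef M * 'C(M, s)%:R); first by ring.
by rewrite b2; field; rewrite gt_eqF // ltr_wpDl.
Qed.

Lemma sin_node n : sin (pi * node n) = (-1) ^+ n.
Proof.
elim: n => [|n IH]; first by rewrite /node add0r sin_pihalf.
rewrite (_ : pi * node n.+1 = pi * node n + pi) ?sinDpi ?IH ?exprS ?mulN1r //.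
by rewrite /node -natr1; ring.
Qed.

Lemma cos_node n : cos (pi * node n) = 0.
Proof.
elim: n => [|n IH]; first by rewrite /node add0r cos_pihalf.
rewrite (_ : pi * node n.+1 = pi * node n + pi) ?cosDpi ?IH ?oppr0 //.
by rewrite /node -natr1; ring.
Qed.

Lemma sine_coef_sum_cvg (b : R) : 0 < b ->
  \sum_(0 <= m < M) sine_coef m * (b ^+ 2) ^+ m @[M --> \oo] --> sin (pi * b) / b.
Proof.
move=> b0; have h := @cvg_cstM R b^-1 _ _ (@cvg_sin_coeff' R (pi * b)).
rewrite mulrC; apply: cvg_near_eq h; near=> M.
rewrite /series /= mulr_sumr; apply: eq_bigr => m _.
rewrite /sin_coeff' /sine_coef -exprM -exprnP exprMn mul2n.
rewrite [b ^+ _.+1]exprS; have f := fact_neq0 m.*2.+1.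
by field; rewrite f gt_eqF.
Unshelve. all: by end_near. Qed.

(** The derivative of sin(pi sqrt v) / sqrt v combines cos(pi sqrt v), which
    vanishes at [v = node n ^+ 2], with the function itself. *)
Lemma taylor_sum1_cvg n :
  taylor_sum (node n ^+ 2) 1 M @[M --> \oo] --> - ((-1) ^+ n / node n) / 2.
Proof.
have a0 := node_gt0 n.
have h1 := sine_coef_sum_cvg a0; rewrite sin_node in h1.
have h2 := @cvg_cstM R (pi / 2) _ _ (@cvg_cos_coeff' R (pi * node n)).
rewrite cos_node mulr0 in h2.
have h3 := @cvg_cstM R (- 2^-1) _ _ h1.
have h := cvgD h2 h3.
rewrite [X in _ --> X](_ : _ = 0 + - 2^-1 * ((-1) ^+ n / node n)); last by field; rewrite gt_eqF.
apply: cvg_near_eq (h _); near=> M.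
rewrite /series /= /taylor_sum !mulr_sumr -big_split /=; apply: eq_bigr => m _.
rewrite /cos_coeff' /sine_coef -exprM -exprnP exprMn mul2n bin1 factS natrM exprS.
have f := fact_neq0 m.*2; have m0 : 0 <= m%:R :> R by [].
have -> : m.*2.+1%:R = 2 * m%:R + 1 :> R by rewrite -natr1 -muln2 natrM mulrC.
by field; rewrite f !gt_eqF //; lra.
Unshelve. all: by end_near. Qed.

(** The coefficient of the theorem, up to a factor. The guard is needed only
    because truncated subtraction makes the binomial 'C(0, 0) for [s = 0] and
    [j > 0]; in all other cases the binomial vanishes by itself. *)
Definition closed_coef s j : R :=
  if (j.*2 <= s)%N then 4 ^- s * (- (4 * pi ^+ 2)) ^+ j / (2 * j)`!%:R * 'C(2 * s - 2 * j, s)%:R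
  else 0.

Lemma bin_diag2 (D s : nat) :
  (s%:R + 2) * (s%:R + 1) * 'C(D.+2, s.+2)%:R = (D%:R + 2) * (D%:R + 1) * 'C(D, s)%:R :> R.
Proof.
have h1 : (s%:R + 2) * 'C(D.+2, s.+2)%:R = (D%:R + 2) * 'C(D.+1, s.+1)%:R :> R.
  by rewrite -!(natrD _ _ 2) !addn2 -!natrM -mul_bin_diag.
have h2 : (s%:R + 1) * 'C(D.+1, s.+1)%:R = (D%:R + 1) * 'C(D, s)%:R :> R.
  by rewrite !natr1 -!natrM -mul_bin_diag.
transitivity ((s%:R + 1) * ((s%:R + 2) * 'C(D.+2, s.+2)%:R) : R); first by ring.
rewrite h1 mulrCA h2; ring.
Qed.

Lemma bin_left (D s : nat) : (s <= D)%N ->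
  (s%:R + 1) * 'C(D, s.+1)%:R = (D%:R - s%:R) * 'C(D, s)%:R :> R.
Proof. by move=> sD; rewrite natr1 -natrB // -!natrM mul_bin_left. Qed.

Lemma inv4S s : 4 ^- s.+1 = 4 ^- s / 4 :> R.
Proof. by rewrite exprS invfM mulrC. Qed.

Lemma closed_coef_rec0 s :
  4 * (s%:R + 2) * (s%:R + 1) * closed_coef s.+2 0 =
  (4 * s%:R + 6) * (s%:R + 1) * closed_coef s.+1 0.
Proof.
rewrite /closed_coef /= !muln0 !subn0 !expr0 fact0 !mul2n !doubleS.
have h1 := bin_diag2 s.*2.+2 s.
have h2 : (s%:R + 1) * 'C(s.*2.+2, s.+1)%:R = (s%:R + 2) * 'C(s.*2.+2, s)%:R :> R.
  rewrite bin_left; last by rewrite -addnn -addn2 -addnA leq_addr.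
  by congr (_ * _); rewrite -addn2 natrD -addnn natrD; ring.
have e : s.*2.+2%:R = 2 * s%:R + 2 :> R by rewrite -addn2 natrD -muln2 natrM mulrC.
rewrite !divr1 !mulr1 !inv4S; move: (4 ^- s) => K.
transitivity (4 * ((s%:R + 2) * (s%:R + 1) * 'C(s.*2.+4, s.+2)%:R) * (K / 4 / 4) : R); first by ring.
transitivity ((4 * s%:R + 6) * ((s%:R + 1) * 'C(s.*2.+2, s.+1)%:R) * (K / 4) : R); last by ring.
by rewrite h1 h2 e; field.
Qed.

Lemma closed_coef_rec s j :
  4 * (s%:R + 2) * (s%:R + 1) * closed_coef s.+2 j.+1 =
  (4 * s%:R + 6) * (s%:R + 1) * closed_coef s.+1 j.+1 - pi ^+ 2 * closed_coef s j.
Proof.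
have [js|sj] := leqP j.*2 s; last first.
  have c0 : (j.*2 <= s)%N = false by rewrite leqNgt sj.
  have c1 : (j.+1.*2 <= s.+1)%N = false by rewrite doubleS ltnS leqNgt ltnS ltnW.
  by rewrite /closed_coef c0 c1 doubleS !ltnS c0; ring.
pose D := (2 * s - 2 * j)%N.
have j2 : (2 * j <= s)%N by rewrite mul2n.
have sD : (s <= D)%N by rewrite /D leq_subRL ?(leq_trans j2) ?leq_pmull // [(2 * s)%N]mul2n -addnn leq_add2r.
have DR : D%:R = 2 * s%:R - 2 * j%:R :> R.
  by rewrite /D natrB ?natrM // (leq_trans j2) ?leq_pmull.
have js' : (j <= s)%N by rewrite (leq_trans _ js) // -addnn leq_addr.
have e1 : (2 * s.+2 - 2 * j.+1 = D.+2)%N.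
  by rewrite -mulnBr subSS subSn // mulnS add2n mulnBr.
have e2 : (2 * s.+1 - 2 * j.+1 = D)%N by rewrite -mulnBr subSS mulnBr.
have c1 : closed_coef s.+1 j.+1 =
   4 ^- s.+1 * (- (4 * pi ^+ 2)) ^+ j.+1 / (2 * j.+1)`!%:R * 'C(D, s.+1)%:R.
  rewrite /closed_coef e2; have [//|] := leqP j.+1.*2 s.+1; rewrite doubleS !ltnS => h; rewrite bin_small ?mulr0 // /D.
  have -> : (s = j.*2)%N by apply/eqP; rewrite eqn_leq h js.
  by rewrite !mul2n -addnn addnK.
have f : (2 * j.+1)`!%:R = (2 * j%:R + 2) * (2 * j%:R + 1) * (2 * j)`!%:R :> R.
  by rewrite mulnS add2n !factS !natrM -!natr1 natrM; ring.
have h1 := bin_diag2 D s; have h2 := bin_left sD.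
have c2 : (j.+1.*2 <= s.+2)%N by rewrite doubleS !ltnS.
rewrite c1 /closed_coef c2 js e1 f -/D.
have f0 := fact_neq0 (2 * j); have j0 : 0 <= j%:R :> R by [].
rewrite !inv4S [(- _) ^+ j.+1]exprS.
move: ((2 * j)`!%:R) (4 ^- s) ((- (4 * pi ^+ 2)) ^+ j) f0 => c K L f0.
transitivity (4 * ((s%:R + 2) * (s%:R + 1) * 'C(D.+2, s.+2)%:R) * (K / 4 / 4) * (- (4 * pi ^+ 2) * L)
   / ((2 * j%:R + 2) * (2 * j%:R + 1) * c)); first by ring.
transitivity ((4 * s%:R + 6) * ((s%:R + 1) * 'C(D, s.+1)%:R) * (K / 4) * (- (4 * pi ^+ 2) * L)
   / ((2 * j%:R + 2) * (2 * j%:R + 1) * c)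
   - pi ^+ 2 * (K * L / c * 'C(D, s)%:R)); last by ring.
rewrite h1 h2 DR; field.
by rewrite f0 !gt_eqF //; lra.
Qed.

Definition closed_poly A s J := \sum_(0 <= j < J) closed_coef s j * A ^+ j.

(** This is the recurrence of [taylor_sum_rec] up to alternating signs, which
    identifies the Taylor coefficients with these polynomials. *)
Lemma closed_poly_rec A s J :
  4 * (s%:R + 2) * (s%:R + 1) * closed_poly A s.+2 J.+1 =
  (4 * s%:R + 6) * (s%:R + 1) * closed_poly A s.+1 J.+1 - pi ^+ 2 * A * closed_poly A s J.
Proof.
rewrite /closed_poly ![\sum_(0 <= j < J.+1) _]big_nat_recl //.
rewrite mulrDr mulrA closed_coef_rec0 [in RHS]mulrDr !mulr_sumr -addrA -mulrA; congr (_ + _).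
rewrite -sumrB; apply: eq_bigr => j _; rewrite [A ^+ _.+1]exprS.
transitivity (4 * (s%:R + 2) * (s%:R + 1) * closed_coef s.+2 j.+1 * (A * A ^+ j)); first by ring.
by rewrite closed_coef_rec; ring.
Qed.

Lemma closed_poly_stable A s J : (s./2 < J)%N -> closed_poly A s J = closed_poly A s s./2.+1.
Proof.
move=> sJ; rewrite /closed_poly (big_cat_nat _ (n := s./2.+1)) //=.
rewrite [X in _ + X](_ : _ = 0) ?addr0 // big_nat big1 //.
move=> j /andP[js _]; by rewrite /closed_coef -geq_half_double leqNgt js mul0r.
Qed.

(** Both sides obey the same recurrence in [s]. At [s = 0, 1] the values of sine
    and cosine at the half-integer multiple [pi * node n] enter, and they are
    [(-1) ^+ n] and 0. *)
Lemma taylor_sum_cvg n s :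
  taylor_sum (node n ^+ 2) s M @[M --> \oo] -->
    (-1) ^+ n / node n * (-1) ^+ s * closed_poly (node n ^+ 2) s s./2.+1.
Proof.
have a0 := node_gt0 n.
suff [] : taylor_sum (node n ^+ 2) s M @[M --> \oo] -->
    (-1) ^+ n / node n * (-1) ^+ s * closed_poly (node n ^+ 2) s s./2.+1 /\
  taylor_sum (node n ^+ 2) s.+1 M @[M --> \oo] -->
    (-1) ^+ n / node n * (-1) ^+ s.+1 * closed_poly (node n ^+ 2) s.+1 s.+1./2.+1 by [].
elim: s => [|s [IH1 IH2]].
  split; last first.
    rewrite [X in _ --> X](_ : _ = - ((-1) ^+ n / node n) / 2); first exact: taylor_sum1_cvg.
    rewrite /closed_poly big_nat1 /closed_coef /= muln0 expr0 fact0 bin1 !expr1 expr0 subn0 muln1; field.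
    by rewrite gt_eqF.
  rewrite [X in _ --> X](_ : _ = sin (pi * node n) / node n); last first.
    rewrite sin_node /closed_poly big_nat1 /closed_coef /= muln0 fact0 bin0 !expr0; field.
    by rewrite gt_eqF.
  apply: cvg_near_eq (sine_coef_sum_cvg a0); near=> M.
  by apply: eq_bigr => m _; rewrite bin0 mulr1.
split=> //.
have s0 : 0 <= s%:R :> R by [].
have h1 := IH2; rewrite -cvg_shiftS in h1.
have h2 := @cvg_cstM R (- ((4 * s%:R + 6) / (4 * (s%:R + 2)))) _ _ h1.
have h3 := @cvg_cstM R (- (pi ^+ 2 * node n ^+ 2 / (4 * (s%:R + 2) * (s%:R + 1)))) _ _ IH1.
have h := cvgD h2 h3.
rewrite [X in _ --> X](_ : _ =
  - ((4 * s%:R + 6) / (4 * (s%:R + 2))) *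
    ((-1) ^+ n / node n * (-1) ^+ s.+1 * closed_poly (node n ^+ 2) s.+1 s.+1./2.+1)
  + - (pi ^+ 2 * node n ^+ 2 / (4 * (s%:R + 2) * (s%:R + 1))) *
    ((-1) ^+ n / node n * (-1) ^+ s * closed_poly (node n ^+ 2) s s./2.+1)).
  rewrite -cvg_shiftS; apply: cvg_near_eq (h _); near=> M.
  have c : 4 * (s%:R + 2) * (s%:R + 1) != 0 :> R by rewrite !mulf_neq0 ?gt_eqF //; lra.
  apply: (mulfI c); rewrite taylor_sum_rec.
  by field; rewrite !gt_eqF //; lra.
rewrite -(@closed_poly_stable _ s.+1 s./2.+2); last by rewrite /= uphalf_half ltnS -[leqRHS]add1n leq_add2r leq_b1.
have := closed_poly_rec (node n ^+ 2) s s./2.+1; rewrite [s.+2./2]/= => h4.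
have -> : closed_poly (node n ^+ 2) s.+2 s./2.+2 =
   ((4 * s%:R + 6) * (s%:R + 1) * closed_poly (node n ^+ 2) s.+1 s./2.+2 -
   pi ^+ 2 * node n ^+ 2 * closed_poly (node n ^+ 2) s s./2.+1) / (4 * (s%:R + 2) * (s%:R + 1)).
  by rewrite -h4; field; rewrite !gt_eqF //; lra.
by rewrite !exprS; field; rewrite !gt_eqF //; lra.
Unshelve. all: by end_near. Qed.

End SineTaylor.

(** * Evaluation of the residues *)

Section Residues.
Implicit Types (m n p q s N : nat) (y v : R).

Lemma gap_prod_down n p : (p <= n)%N ->
  \prod_(p <= m < n) inv_gap n m = (-1) ^+ (n + p) * fact_ratio n p / (2 * n)`!%:R.
Proof.
move=> pn; rewrite -(subKn pn); move: (n - p)%N (leq_subr p n) => d {p pn} + .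
elim: d => [|d IH] dn.
  rewrite subn0 big_geq // /fact_ratio subnn fact0 divr1 addnn -mul2n exprM sqrrN expr1n.
  by rewrite expr1n mul1r divff // fact_neq0.
rewrite big_ltn ?ltn_subrL ?(leq_trans _ dn) // subnSK // IH ?(ltnW dn) //.
have -> : (n - d = (n - d.+1).+1)%N by rewrite subnSK.
set p := (n - d.+1)%N; have pn : (p < n)%N by rewrite /p ltn_subrL (leq_trans _ dn).
rewrite (fact_ratioSp pn) addnS exprS /inv_gap sqr_node_sub.
have f := fact_neq0 (2 * n).
have pnR : p%:R < n%:R :> R by rewrite ltr_nat.
have p0 : 0 <= p%:R :> R by [].
field; apply/and3P; split; [by [] | rewrite gt_eqF //; lra | by rewrite lt_eqF // subr_lt0].
Qed.

Lemma gap_prod_up n d :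
  \prod_(n.+1 <= m < (n + d).+1) inv_gap n m =
    (2 * n).+1`!%:R / (d`!%:R * (n + d + n).+1`!%:R).
Proof.
elim: d => [|d IH].
  by rewrite addn0 big_geq // fact0 mul1r addnn -mul2n divff // fact_neq0.
rewrite addnS big_nat_recr /=; last by rewrite ltnS leq_addr.
have n0 : 0 <= n%:R :> R by []; have d0 : 0 <= d%:R :> R by [].
have -> : (n + d + n).+2`!%:R = (2 * n%:R + d%:R + 2) * (n + d + n).+1`!%:R :> R.
  by rewrite factS natrM -natr1 -natr1 !natrD; congr (_ * _); ring.
have -> : d.+1`!%:R = (d%:R + 1) * d`!%:R :> R by rewrite factS natrM natr1.
rewrite IH /inv_gap sqr_node_sub -[(n + d).+1%:R]natr1 natrD.
move: (fact_neq0 d) (fact_neq0 (n + d + n).+1) => f f'.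
by field; rewrite f f' /= !gt_eqF //; lra.
Qed.

(** With [y = node n ^+ 2 - v] each factor [1 + inv_gap n m * y] equals
    [inv_gap n m * shift v m], and [y] itself is [shift v n]. *)
Lemma lower_sum_shift n y (f : nat -> R) (v := node n ^+ 2 - y) :
  lower_sum (fun m => inv_gap n m * y) f n n = (-1) ^+ n / (2 * n)`!%:R * lower_series v f n.
Proof.
have fac m : (m < n)%N -> 1 + inv_gap n m * y = inv_gap n m * shift v m.
  move=> mn; rewrite /inv_gap /shift /v; field; rewrite sqr_node_sub.
  by rewrite mulf_neq0 // ?subr_eq0 ?eqr_nat ?(ltn_eqF mn) // gt_eqF // ltr_wpDl ?addr_ge0.
have yE : y = shift v n by rewrite /shift /v; ring.
rewrite /lower_sum /lower_series [in RHS]big_nat_recr //= [\prod_(n.+1 <= m < n.+1) _]big_geq //.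
rewrite mulr1 mulrDr addrC.
congr (_ + _); last first.
  have := gap_prod_down (leqnn n); rewrite big_geq // => h.
  have h2 : (-1) ^+ (n + n) = 1 :> R by rewrite addnn -mul2n exprM sqrrN !expr1n.
  rewrite h2 mul1r in h.
  transitivity ((-1) ^+ (n + n) * (fact_ratio n n / (2 * n)`!%:R) * f n).
    by rewrite h2 -h !mul1r.
  by rewrite exprD; ring.
rewrite mulr_sumr !big_nat; apply: eq_bigr => p /andP[_ pn].
have -> : \prod_(p.+1 <= m < n) (1 + inv_gap n m * y) =
   \prod_(p.+1 <= m < n) inv_gap n m * \prod_(p.+1 <= m < n) shift v m.
  rewrite -big_split !big_nat; apply: eq_bigr => m /andP[_ mn]; exact: fac.
have := gap_prod_down (ltnW pn); rewrite big_ltn // => h.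
rewrite [\prod_(p.+1 <= m < n.+1) _]big_nat_recr //= {1}yE.
transitivity (f p * (inv_gap n p * \prod_(p.+1 <= m < n) inv_gap n m)
   * \prod_(p.+1 <= m < n) shift v m * shift v n); first by ring.
by rewrite h exprD; ring.
Qed.

Lemma upper_sum_shift n N y (f : nat -> R) (v := node n ^+ 2 - y) : (n < N)%N ->
  upper_sum (fun m => inv_gap n m * y) (fun q => (f q)^-1) n N =
  (2 * n).+1`!%:R * upper_series v f n N.
Proof.
move=> nN.
have fac m : (n < m)%N -> 1 + inv_gap n m * y = inv_gap n m * shift v m.
  move=> nm; rewrite /inv_gap /shift /v; field; rewrite sqr_node_sub.
  by rewrite mulf_neq0 // ?subr_eq0 ?eqr_nat ?(gtn_eqF nm) // gt_eqF // ltr_wpDl ?addr_ge0.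
have yE : y = shift v n by rewrite /shift /v; ring.
rewrite /upper_sum /upper_series [in RHS]big_ltn //= [\prod_(n <= m < n) _]big_geq // mul1r mulrDr.
congr (_ + _).
  by rewrite subnn fact0 mul1r addnn -mul2n invfM mulrA divff ?mul1r // fact_neq0.
rewrite mulr_sumr !big_nat; apply: eq_bigr => q /andP[nq _].
have -> : \prod_(n.+1 <= m < q) (1 + inv_gap n m * y) =
   \prod_(n.+1 <= m < q) inv_gap n m * \prod_(n.+1 <= m < q) shift v m.
  rewrite -big_split !big_nat; apply: eq_bigr => m /andP[nm _]; exact: fac.
have := gap_prod_up n (q - n); rewrite (subnKC (ltnW nq)) big_nat_recr //= => h.
rewrite [\prod_(n <= m < q) _]big_ltn // {1}yE invfM.
transitivity ((f q)^-1 * (\prod_(n.+1 <= m < q) inv_gap n m * inv_gap n q)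
   * \prod_(n.+1 <= m < q) shift v m * shift v n); first by ring.
by rewrite h; ring.
Qed.

End Residues.

Section ResidueLimit.
Implicit Types (m n p q N i : nat) (y v : R) (s : seq nat).

Definition end_weight s : R :=
  wt (head 0%N s) / wt (last 0%N s) * (1 + node (head 0%N s) / node (last 0%N s)).

(** The contribution of the chains of length [r] through [n] to the pole at
    [n], truncated at [N]. *)
Definition residue n r N : R :=
  \sum_(s <- chains N | (n \in s) && (size s == r))
     end_weight s * \prod_(m <- s | m != n) inv_gap n m.

(** The generating polynomial of the residues in the number of entries other
    than [n]. *)
Definition residue_poly n N : {poly R} :=
  \sum_(s <- chains N | n \in s)
     (end_weight s * \prod_(m <- s | m != n) inv_gap n m) *: 'X^((size s).-1).

Lemma coef_residue_poly n N i : (residue_poly n N)`_i = residue n i.+1 N.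
Proof.
rewrite /residue_poly coef_sum /residue big_mkcondr /=.
apply: eq_bigr => s ns; rewrite coefZ coefXn.
have -> : (i == (size s).-1) = (size s == i.+1) by case: s ns => //= x s _; rewrite eqSS eq_sym.
by case: eqP => _; rewrite ?mulr1 ?mulr0.
Qed.

Lemma end_weight_gt0 s : 0 < end_weight s.
Proof.
by rewrite /end_weight mulr_gt0 ?addr_gt0 ?divr_gt0 ?wt_gt0 ?node_gt0.
Qed.

Lemma residue_norm_le n r N : (n < N)%N -> `|residue n r N| <= 78 / wt n.
Proof.
move=> nN; apply: le_trans (sum_chains_abs_le nN).
apply: le_trans (ler_norm_sum _ _ _) _; rewrite big_mkcondr /=.
apply: ler_sum => s ns; case: ifP => _; last first.
  by rewrite mulr_ge0 ?prodr_ge0 // ltW // -/(end_weight s) end_weight_gt0.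
by rewrite normrM normr_prod ger0_norm // ltW // end_weight_gt0.
Qed.

Lemma residue_eq0 n r N : (N <= n)%N -> residue n r N = 0.
Proof.
move=> Nn; rewrite /residue big_seq_cond big1 // => s /andP[sN /andP[ns _]].
by have := mem_chain_lt sN ns; rewrite ltnNge Nn.
Qed.

Lemma residue_norm_le_all n r N : `|residue n r N| <= 78 / wt n.
Proof.
have [Nn|nN] := leqP N n; last exact: residue_norm_le.
by rewrite residue_eq0 // normr0 divr_ge0 // ltW // wt_gt0.
Qed.

Lemma prod_gap_scale s n y : uniq s -> n \in s ->
  \prod_(m <- s | m != n) (inv_gap n m * y) =
  \prod_(m <- s | m != n) inv_gap n m * y ^+ (size s).-1.
Proof.
move=> us ns; rewrite big_split /= big_const_seq iter_mulr_1.
have -> : count (fun m => m != n) s = (size s).-1.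
  by rewrite -size_filter -rem_filter // size_rem.
by [].
Qed.

(** The factor [1 + node (head s) / node (last s)] splits the sum into two, and
    each of them factors at [n]. *)
Lemma horner_residue_poly n N y : (n < N)%N ->
  (residue_poly n N).[y] = (-1) ^+ n * (2 * node n) * pairing (node n ^+ 2 - y) n N.
Proof.
move=> nN; rewrite /residue_poly horner_sum.
transitivity (\sum_(s <- chains N | n \in s) wt (head 0%N s) * (wt (last 0%N s))^-1
     * \prod_(m <- s | m != n) (inv_gap n m * y) +
  \sum_(s <- chains N | n \in s) wt_node (head 0%N s) * (wt_node (last 0%N s))^-1
     * \prod_(m <- s | m != n) (inv_gap n m * y)).
  rewrite -big_split big_seq_cond [RHS]big_seq_cond; apply: eq_bigr => s /andP[sN ns] /=.
  rewrite hornerZ hornerXn (prod_gap_scale _ (mem_chain_uniq sN) ns) /end_weight /wt_node.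
  by field; rewrite !gt_eqF ?wt_gt0 ?node_gt0.
have T f g := @sum_chains_through R (fun m => inv_gap n m * y) f g n N nN.
rewrite (T wt (fun q => (wt q)^-1)) (T (wt_node) (fun q => (wt_node q)^-1)).
rewrite !lower_sum_shift !upper_sum_shift //.
rewrite /pairing factS natrM -natr1 natrM /node.
have f := fact_neq0 (2 * n).
by field.
Qed.

Definition sine_poly (A : R) M : {poly R} :=
  \sum_(0 <= m < M) sine_coef m *: (A%:P - 'X) ^+ m.

Lemma horner_sine_poly A M y :
  (sine_poly A M).[y] = \sum_(0 <= m < M) sine_coef m * (A - y) ^+ m.
Proof.
rewrite /sine_poly horner_sum; apply: eq_bigr => m _.
by rewrite hornerZ horner_exp !hornerE.
Qed.

Lemma sub_polyX_exp (A : R) m : (A%:P - 'X) ^+ m =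
  \poly_(j < m.+1) ((-1) ^+ j * A ^+ (m - j) * 'C(m, j)%:R).
Proof.
rewrite exprDn poly_def; apply: eq_bigr => j _.
rewrite -mul_polyC !polyCM !rmorphXn /= polyCN polyC1 polyC_natr exprNn -mulr_natr.
by ring.
Qed.

Lemma coef_sine_poly A M i : A != 0 ->
  (sine_poly A M)`_i = (-1) ^+ i * A ^- i * taylor_sum A i M.
Proof.
move=> A0; rewrite /sine_poly coef_sum /taylor_sum mulr_sumr; apply: eq_bigr => m _.
rewrite coefZ sub_polyX_exp coef_poly ltnS; case: leqP => im; last first.
  by rewrite bin_small // !(mulr0, mul0r).
have -> : A ^+ m = A ^+ (m - i) * A ^+ i by rewrite -exprD subnK.
by field; rewrite expf_neq0.
Qed.

Lemma sine_coef_sum_bounded (B : R) : 0 <= B ->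
  exists C, forall M, \sum_(0 <= m < M) `|sine_coef m| * B ^+ m <= C.
Proof.
move=> B0; exists (pi * expR (pi ^+ 2 * B)) => M.
have pi0 : 0 <= pi :> R := ltW (pi_gt0 R).
have e0 : 0 <= pi ^+ 2 * B by rewrite mulr_ge0 // exprn_ge0.
apply: le_trans (_ : pi * series (exp_coeff (pi ^+ 2 * B)) M <= _); last first.
  rewrite ler_wpM2l //; apply: nondecreasing_cvgn_le; last exact: is_cvg_series_exp_coeff.
  apply/nondecreasing_seqP => k; rewrite /series /= big_nat_recr //= lerDl.
  exact: exp_coeff_ge0.
rewrite /series /= mulr_sumr; apply: ler_sum => m _.
have -> : `|sine_coef m| = pi * (pi ^+ 2) ^+ m / m.*2.+1`!%:R.
  rewrite /sine_coef !normrM normr_sign mul1r normfV !ger0_norm ?exprn_ge0 //.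
  by rewrite -exprM mul2n exprS.
rewrite /exp_coeff /= [(_ * B) ^+ m]exprMn.
rewrite [leLHS](_ : _ = pi * (pi ^+ 2) ^+ m * B ^+ m * (m.*2.+1`!%:R)^-1); last exact: mulrAC.
rewrite [leRHS](_ : _ = pi * (pi ^+ 2) ^+ m * B ^+ m * (m`!%:R)^-1); last by rewrite !mulrA.
rewrite ler_wpM2l ?mulr_ge0 ?exprn_ge0 //.
rewrite lef_pV2 ?posrE ?ltr0n ?fact_gt0 // ler_nat leq_fact // -addnn.
by rewrite (leq_trans (leq_addr m m)).
Qed.

(** Each ['C(m, i) * A ^+ (m - i)] is at most [(A + 1) ^+ m], which leaves a
    convergent series. *)
Lemma coef_sine_poly_bounded (A : R) : 0 <= A ->
  exists C, forall M i, `|(sine_poly A M)`_i| <= C.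
Proof.
move=> A0; have [C hC] := @sine_coef_sum_bounded (A + 1) (addr_ge0 A0 ler01).
exists C => M i; apply: le_trans (hC M).
rewrite /sine_poly coef_sum; apply: le_trans (ler_norm_sum _ _ _) _.
apply: ler_sum => m _; rewrite coefZ normrM ler_wpM2l //.
rewrite sub_polyX_exp coef_poly; case: ifP => [im|_]; last first.
  by rewrite normr0 exprn_ge0 // addr_ge0.
rewrite !normrM normr_sign mul1r !ger0_norm ?exprn_ge0 //.
rewrite exprDn (bigD1 (Ordinal im)) //= expr1n mulr1 mulr_natr lerDl.
by apply: sumr_ge0 => j _; rewrite mulrn_wge0 // mulr_ge0 ?exprn_ge0.
Qed.

(** The difference of [residue_poly] and of a multiple of [sine_poly] tends to 0
    at every [y] between 0 and [A], since [pairing] tends to sin(pi b) / b with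
    [b ^+ 2 = A - y]; by [coef_cvg0] it does so coefficientwise, and the
    coefficients of [sine_poly] are known from [taylor_sum_cvg]. *)
Lemma residue_cvg n i :
  residue n i.+1 N @[N --> \oo] -->
    2 * (node n ^+ 2) ^- i * closed_poly (node n ^+ 2) i i./2.+1.
Proof.
set A := node n ^+ 2.
have a0 := node_gt0 n.
have A0 : 0 < A by rewrite exprn_gt0.
pose c : R := (-1) ^+ n * (2 * node n).
pose D N := residue_poly n N - c *: sine_poly A N.
have [C hC] := coef_sine_poly_bounded (ltW A0).
have DC N j : `|(D N)`_j| <= 78 / wt n + `|c| * C.
  rewrite /D coefB coefZ coef_residue_poly.
  apply: le_trans (ler_normB _ _) _; rewrite lerD ?residue_norm_le_all //.
  by rewrite normrM ler_wpM2l.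
have D0 y : 0 < y < A -> (D N).[y] @[N --> \oo] --> (0 : R).
  move=> /andP[y0 yA].
  have v0 : 0 < A - y by rewrite subr_gt0.
  pose b := Num.sqrt (A - y).
  have b0 : 0 < b by rewrite sqrtr_gt0.
  have bv : b ^+ 2 = A - y by rewrite sqr_sqrtr // ltW.
  have h1 := sum_gauss_cvg b0; have h2 := sine_coef_sum_cvg b0.
  rewrite bv in h1 h2.
  have h3 : pairing (A - y) 0 N @[N --> \oo] --> sin (pi * b) / b.
    by apply: cvg_near_eq h1; near=> N; rewrite pairing0.
  have h4 := @cvg_cstM R c _ _ (pairing_cvg (ltW v0) n h3).
  have h5 := @cvg_cstM R c _ _ h2.
  have h := cvgB h4 h5; rewrite subrr in h.
  apply: cvg_near_eq (h _); near=> N.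
  have nN : (n < N)%N by near: N; exists n.+1.
  by rewrite /D hornerD hornerN hornerZ horner_sine_poly horner_residue_poly.
have := coef_cvg0 A0 DC D0 i => h1.
have h2 := @cvg_cstM R (c * ((-1) ^+ i * A ^- i)) _ _ (@taylor_sum_cvg n i).
have h := cvgD h1 h2.
rewrite [X in _ --> X](_ : _ = 0 + c * ((-1) ^+ i * A ^- i) *
  ((-1) ^+ n / node n * (-1) ^+ i * closed_poly A i i./2.+1)); last first.
  rewrite /c add0r.
  have sgn k : (-1) ^+ k * (-1) ^+ k = 1 :> R by rewrite -exprMn mulrNN mulr1 expr1n.
  transitivity (((-1) ^+ n * (-1) ^+ n) * ((-1) ^+ i * (-1) ^+ i) * 2 * A ^- i *
    closed_poly A i i./2.+1); first by rewrite !sgn !mul1r.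
  by field; rewrite expf_neq0 ?gt_eqF.
apply: cvg_near_eq (h _); near=> N.
rewrite /D coefB coefZ coef_residue_poly coef_sine_poly ?gt_eqF //.
by ring.
Unshelve. all: by end_near. Qed.

End ResidueLimit.

(** * Multiple sums as sums of residues *)

Section Assembly.
Local Notation sqinv := (fun m => (node m ^+ 2)^-1).

Lemma node_inj : injective node.
Proof. by move=> m n /addIr /eqP; rewrite eqr_nat => /eqP. Qed.

Lemma sqinv_inj : injective sqinv.
Proof.
move=> m n /invr_inj /eqP; rewrite eqrXn2 ?(ltW (node_gt0 _)) // => /eqP.
exact: node_inj.
Qed.

(** With poles at the inverse squares of the nodes, [z / (x - z)] becomes
    [node m ^+ 2 * inv_gap m z]. *)
Lemma composition_sum k r (n : r.-tuple nat) : (0 < r)%N -> (0 < k)%N -> uniq n ->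
  \sum_(t : r.-tuple 'I_k.+1 | is_composition t)
     \prod_(i < r) sqinv (tnth n i) ^+ tnth t i =
  \sum_(m <- n) (node m ^+ 2) ^+ r.-1 / (node m ^+ 2) ^+ k * \prod_(z <- n | z != m) inv_gap m z.
Proof.
move=> r0 k0 un; rewrite sum_compositions.
have -> : \prod_(i < r) parts_poly k (sqinv (tnth n i)) =
    \prod_(x <- [seq sqinv m | m <- n]) parts_poly k x.
  by rewrite big_map big_tuple.
rewrite coef_prod_parts ?k0 ?leqnn ?size_map ?size_tuple ?(map_inj_uniq sqinv_inj) //.
rewrite big_map !big_seq; apply: eq_bigr => m mn.
have -> : (node m ^+ 2) ^+ r.-1 / (node m ^+ 2) ^+ k * \prod_(z <- n | z != m) inv_gap m z =
   sqinv m ^+ k * (\prod_(z <- n | z != m) inv_gap m z * (node m ^+ 2) ^+ (size n).-1).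
  by rewrite size_tuple exprVn mulrC; ring.
rewrite -prod_gap_scale //; congr (_ * _).
rewrite /residue_factor big_map; apply: eq_big => [z|z zm].
  by rewrite (inj_eq sqinv_inj).
rewrite (inj_eq sqinv_inj) in zm.
have a0 := node_gt0 m; have b0 := node_gt0 z.
have d0 : node z ^+ 2 - node m ^+ 2 != 0.
  by rewrite subr_eq0 eqrXn2 ?(ltW (node_gt0 _)) // (inj_eq node_inj).
by rewrite /inv_gap; field; rewrite d0 !gt_eqF.
Qed.

Lemma ZtermE r (k n : r.-tuple nat) : Zterm R k n =
  wt (head 0%N n) / wt (last 0%N n) * (\prod_(i < r) node (tnth n i) ^+ tnth k i)^-1.
Proof. by rewrite /Zterm !wtE invf_div mulrAC. Qed.

Lemma Zterm_double k r (t : r.-tuple 'I_k.+1) (n : r.-tuple nat) :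
  Zterm R (double_index t) n = wt (head 0%N n) / wt (last 0%N n) *
    \prod_(i < r) sqinv (tnth n i) ^+ tnth t i.
Proof.
rewrite ZtermE -prodfV; congr (_ * _); apply: eq_bigr => i _.
by rewrite tnth_mktuple exprM exprVn.
Qed.

(** Moving one unit of exponent from the first node to the last multiplies the
    summand by their quotient. The lowered exponent is not truncated because the
    first part is positive. *)
Lemma Zterm_shifted k r (t : r.-tuple 'I_k.+1) (n : r.-tuple nat) :
  (0 < r)%N -> is_composition t ->
  Zterm R (shifted_index t) n = Zterm R (double_index t) n *
    (node (head 0%N n) / node (last 0%N n)).
Proof.
case: r t n => // r t n _ /andP[/forallP t0 _].
rewrite !ZtermE -[RHS]mulrA; congr (_ * _).
have h0 : head 0%N n = tnth n ord0 by rewrite (tnth_nth 0%N) nth0.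
have h1 : last 0%N n = tnth n ord_max by rewrite (tnth_nth 0%N) -nth_last size_tuple.
have e : \prod_(i < r.+1) node (tnth n i) ^+ tnth (shifted_index t) i * node (head 0%N n) =
   \prod_(i < r.+1) node (tnth n i) ^+ tnth (double_index t) i * node (last 0%N n).
  have p0 : node (head 0%N n) = \prod_(i < r.+1) node (tnth n i) ^+ (i == 0 :> nat).
    by rewrite big_ord_recl /= expr1 big1 ?mulr1 ?h0 // => i _; rewrite expr0.
  have p1 : node (last 0%N n) = \prod_(i < r.+1) node (tnth n i) ^+ (i == r :> nat).
    rewrite big_ord_recr /= eqxx expr1 big1 ?mul1r ?h1 // => i _.
    by rewrite ltn_eqF ?expr0 //= ltn_ord.
  rewrite p0 p1 -!big_split; apply: eq_bigr => i _ /=; rewrite -!exprD !tnth_mktuple /=.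
  congr (_ ^+ _); rewrite addnAC subnK //.
  case: eqP => // _; apply: leq_trans (t0 i) _; exact: leq_pmull.
have a0 := node_gt0 (head 0%N n); have a1 := node_gt0 (last 0%N n).
have P0 : \prod_(i < r.+1) node (tnth n i) ^+ tnth (double_index t) i != 0.
  by apply/prodf_neq0 => i _; rewrite expf_neq0 // gt_eqF ?node_gt0.
have P1 : \prod_(i < r.+1) node (tnth n i) ^+ tnth (shifted_index t) i != 0.
  by apply/prodf_neq0 => i _; rewrite expf_neq0 // gt_eqF ?node_gt0.
apply: (mulfI P1); rewrite mulfV //; move: e P0 P1.
set dbl := \prod_(i < r.+1) node (tnth n i) ^+ tnth (double_index t) i.
set shf := \prod_(i < r.+1) node (tnth n i) ^+ tnth (shifted_index t) i => e P0 P1.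
transitivity (shf * node (head 0%N n) / (dbl * node (last 0%N n))).
  by rewrite e mulfV // mulf_neq0 // gt_eqF.
by field; rewrite P0 !gt_eqF.
Qed.

(** The two summands of the left-hand side, added up over all compositions of
    [k] at a fixed chain. *)
Definition total_weight k r (s : seq nat) : R :=
  end_weight s * \sum_(m <- s) (node m ^+ 2) ^+ r.-1 / (node m ^+ 2) ^+ k
     * \prod_(z <- s | z != m) inv_gap m z.

Lemma sum_Zterm_compositions k r (n : r.-tuple nat) : (0 < r)%N -> (0 < k)%N -> sorted ltn n ->
  \sum_(t : r.-tuple 'I_k.+1 | is_composition t)
     (Zterm R (double_index t) n + Zterm R (shifted_index t) n) = total_weight k r n.
Proof.
move=> r0 k0 sn; rewrite /total_weight -composition_sum //; last exact: sorted_uniq ltn_trans ltnn _ sn.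
rewrite mulr_sumr; apply: eq_bigr => t tc.
by rewrite Zterm_shifted // Zterm_double /end_weight; ring.
Qed.

Lemma sum_chain_range N s (f : nat -> R) : s \in chains N ->
  \sum_(m <- s) f m = \sum_(0 <= m < N | m \in s) f m.
Proof.
move=> sN; rewrite -[RHS]big_filter; apply: perm_big; apply: uniq_perm.
- exact: mem_chain_uniq sN.
- exact/filter_uniq/iota_uniq.
- move=> m; rewrite mem_filter mem_index_iota /=.
  by case: (boolP (m \in s)) => //= ms; rewrite (mem_chain_lt sN ms).
Qed.

(** Exchange of the sum over chains with the sum over their entries. *)
Lemma sum_total_weight k r N :
  \sum_(s <- chains N | size s == r) total_weight k r s =
  \sum_(0 <= m < N) (node m ^+ 2) ^+ r.-1 / (node m ^+ 2) ^+ k * residue m r N.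
Proof.
transitivity (\sum_(s <- chains N | size s == r) \sum_(0 <= m < N | m \in s)
   (node m ^+ 2) ^+ r.-1 / (node m ^+ 2) ^+ k *
     (end_weight s * \prod_(z <- s | z != m) inv_gap m z)).
  rewrite big_seq_cond [RHS]big_seq_cond; apply: eq_bigr => s /andP[sN _].
  rewrite /total_weight (sum_chain_range _ sN) mulr_sumr; apply: eq_bigr => m _; ring.
rewrite (exchange_big_dep xpredT) //=; apply: eq_bigr => m _.
rewrite /residue mulr_sumr; apply: eq_bigl => s; exact: andbC.
Qed.

Lemma sum_size1_chains N (F : seq nat -> R) :
  \sum_(s <- chains N | size s == 1%N) F s = \sum_(0 <= m < N) F [:: m].
Proof.
have size0 M (G : seq nat -> R) : \sum_(s <- chains M | size s == 0%N) G s = G [::].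
  elim: M => [|M IH]; first by rewrite big_mkcond big_seq1.
  rewrite sum_chainsS IH big1 ?addr0 // => s.
  by rewrite size_rcons.
elim: N => [|N IH]; first by rewrite big_mkcond big_seq1 big_geq.
rewrite sum_chainsS IH big_nat_recr //=; congr (_ + _).
by under eq_bigl do rewrite size_rcons eqSS; rewrite size0.
Qed.

Lemma inv_node_sqr_le4 m : (node m ^+ 2)^-1 <= 4.
Proof.
rewrite -[leRHS]invrK lef_pV2 ?posrE ?invr_gt0 ?exprn_gt0 ?node_gt0 //.
have -> : 4^-1 = (2^-1) ^+ 2 :> R by field.
by rewrite lerXn2r ?nnegrE ?invr_ge0 ?(ltW (node_gt0 _)) // /node lerDr.
Qed.

Lemma inv_node_pow_le e m : (0 < e)%N ->
  ((node m ^+ 2) ^+ e)^-1 <= 4 ^+ e.-1 * (node m ^+ 2)^-1.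
Proof.
case: e => // e _ /=; rewrite exprS invfM mulrC.
have a0 : 0 <= (node m ^+ 2)^-1 by rewrite invr_ge0 exprn_ge0 // ltW ?node_gt0.
by rewrite ler_wpM2r // -exprVn lerXn2r ?nnegrE // inv_node_sqr_le4.
Qed.

Lemma Z_depth1 e : (0 < e)%N ->
  exists2 z : R, \sum_(0 <= m < N) ((node m ^+ 2) ^+ e)^-1 @[N --> \oo] --> z &
    Z R [tuple (2 * e)%N] = z%:E.
Proof.
move=> e0; pose u N := \sum_(0 <= m < N) ((node m ^+ 2) ^+ e)^-1.
have t0 m : 0 <= ((node m ^+ 2) ^+ e)^-1 by rewrite invr_ge0 !exprn_ge0 // ltW ?node_gt0.
have uS : nondecreasing_seq u.
  by apply/nondecreasing_seqP => N; rewrite /u big_nat_recr //= lerDl.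
have cu : cvgn u.
  apply: nondecreasing_is_cvgn => //; exists (4 ^+ e.-1 * 8) => _ [N _ <-].
  apply: le_trans (_ : 4 ^+ e.-1 * \sum_(0 <= m < N) (node m ^+ 2 * wt m)^-1 <= _); last first.
    by rewrite ler_wpM2l ?exprn_ge0 // sum_inv_node_sqr_le.
  rewrite mulr_sumr; apply: ler_sum => m _; apply: le_trans (inv_node_pow_le m e0) _.
  rewrite ler_wpM2l ?exprn_ge0 // [leRHS]invfM ler_peMr ?invf_ge1 ?wt_gt0 ?wt_le1 //.
  by rewrite invr_ge0 exprn_ge0 // ltW ?node_gt0.
exists (limn u) => //.
pose F (s : seq nat) : R := ((node (head 0%N s) ^+ 2) ^+ e)^-1.
have -> : Z R [tuple (2 * e)%N] =
    (\esum_(n in [set n : 1.-tuple nat | sorted ltn n]) (F n)%:E)%E.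
  apply: eq_esum => n _; congr (_%:E).
  rewrite ZtermE big_ord1 (tnth_nth 0%N) nth0 -nth_last size_tuple nth0.
  by rewrite divff ?gt_eqF ?wt_gt0 // mul1r /F (tnth_nth 0%N) /= exprM.
apply: esum_sorted_tuples => [s _|]; first exact: t0.
have -> : (fun N => \sum_(s <- chains N | size s == 1%N) F s) = u.
  by apply/funext => N; rewrite sum_size1_chains.
exact: cu.
Qed.

(** Replacing each truncated residue by its limit costs nothing in the limit:
    [A ^- (k - r + 1)] is [O(A ^- 1)] for [A = node m ^+ 2], and
    [sum_inv_node_sqr_le] provides the dominating series. *)
Lemma residue_sum_cvg k r : (0 < r <= k)%N ->
  \sum_(0 <= m < N) (node m ^+ 2) ^+ r.-1 / (node m ^+ 2) ^+ k *
     (residue m r N - 2 * (node m ^+ 2) ^- r.-1 * closed_poly (node m ^+ 2) r.-1 r.-1./2.+1)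
  @[N --> \oo] --> (0 : R).
Proof.
move=> /andP[r0 rk].
pose c m := 2 * (node m ^+ 2) ^- r.-1 * closed_poly (node m ^+ 2) r.-1 r.-1./2.+1.
have rc m : residue m r N @[N --> \oo] --> c m.
  by have := @residue_cvg m r.-1; rewrite prednK.
pose g m := 4 ^+ (k - r) * 156 * (node m ^+ 2 * wt m)^-1.
apply: (@tannery R g _ (4 ^+ (k - r) * 156 * 8)) => [N|m N|m].
- by rewrite -mulr_sumr ler_wpM2l ?mulr_ge0 ?exprn_ge0 // sum_inv_node_sqr_le.
- have A0 : 0 < node m ^+ 2 by rewrite exprn_gt0 ?node_gt0.
  have hc : `|c m| <= 78 / wt m.
    apply: (ler_cvg_to (cvg_norm (rc m)) (cvg_cst _)).
    by apply: nearW => M; exact: residue_norm_le_all.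
  have h : `|residue m r N - c m| <= 156 / wt m.
    apply: le_trans (ler_normB _ _) _; have := residue_norm_le_all m r N.
    have -> : 156 / wt m = 78 / wt m + 78 / wt m by ring.
    by move=> h; exact: lerD.
  rewrite normrM /g.
  have -> : (node m ^+ 2) ^+ r.-1 / (node m ^+ 2) ^+ k = ((node m ^+ 2) ^+ (k - r).+1)^-1.
    rewrite -{1}(subnK rk) -{3}(prednK r0) addnS -addSn exprD invfM mulrCA divff ?mulr1 //.
    by rewrite expf_neq0 // gt_eqF.
  have p0 : 0 <= ((node m ^+ 2) ^+ (k - r).+1)^-1 by rewrite invr_ge0 exprn_ge0 // ltW.
  rewrite ger0_norm //.
  rewrite [leRHS](_ : _ = (4 ^+ (k - r) * (node m ^+ 2)^-1) * (156 / wt m)); last first.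
    by rewrite invfM; ring.
  by apply: ler_pM => //; exact: inv_node_pow_le.
- rewrite -[X in _ --> X](mulr0 ((node m ^+ 2) ^+ r.-1 / (node m ^+ 2) ^+ k)).
  apply: cvg_cstM; rewrite -(subrr (c m)); apply: cvgB; [exact: rc | exact: cvg_cst].
Qed.

Lemma sum_total_weight_cvg k r (z : nat -> R) : (0 < r <= k)%N ->
  (forall j, (j <= r.-1./2)%N ->
    \sum_(0 <= m < N) ((node m ^+ 2) ^+ (k - j))^-1 @[N --> \oo] --> z j) ->
  \sum_(s <- chains N | size s == r) total_weight k r s @[N --> \oo] -->
    \sum_(j < r.-1./2.+1) 2 * closed_coef r.-1 j * z j.
Proof.
move=> rk zj; have /andP[r0 rk'] := rk.
have h1 := residue_sum_cvg rk.
have h2 : \sum_(j < r.-1./2.+1) 2 * closed_coef r.-1 j *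
    \sum_(0 <= m < N) ((node m ^+ 2) ^+ (k - j))^-1 @[N --> \oo] -->
    \sum_(j < r.-1./2.+1) 2 * closed_coef r.-1 j * z j.
  apply: (@cvg_finite_sum R 'I_(r.-1./2.+1) _ _ (fun j N => 2 * closed_coef r.-1 j *
    \sum_(0 <= m < N) ((node m ^+ 2) ^+ (k - j))^-1)) => j _.
  by apply: cvg_cstM; apply: zj; rewrite -ltnS.
have h := cvgD h1 h2; rewrite add0r in h.
apply: cvg_near_eq (h _); near=> N; rewrite sum_total_weight.
transitivity (\sum_(0 <= m < N) (node m ^+ 2) ^+ r.-1 / (node m ^+ 2) ^+ k *
     (residue m r N - 2 * (node m ^+ 2) ^- r.-1 * closed_poly (node m ^+ 2) r.-1 r.-1./2.+1)
  + \sum_(0 <= m < N) \sum_(j < r.-1./2.+1) 2 * closed_coef r.-1 j * ((node m ^+ 2) ^+ (k - j))^-1).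
  congr (_ + _); rewrite exchange_big /=; apply: eq_bigr => j _.
  by rewrite mulr_sumr.
rewrite -big_split; apply: eq_bigr => m _ /=.
have A0 : (node m ^+ 2) != 0 by rewrite expf_neq0 // gt_eqF ?node_gt0.
have -> : \sum_(j < r.-1./2.+1) 2 * closed_coef r.-1 j * ((node m ^+ 2) ^+ (k - j))^-1 =
   2 * closed_poly (node m ^+ 2) r.-1 r.-1./2.+1 / (node m ^+ 2) ^+ k.
  rewrite /closed_poly big_mkord mulr_sumr mulr_suml; apply: eq_bigr => j _.
  have jk : (j <= k)%N.
    have : (j.*2 <= r.-1)%N by rewrite -geq_half_double -ltnS.
    rewrite -addnn => /(leq_trans (leq_addr j j)) hj.
    exact: leq_trans hj (leq_trans (leq_pred r) rk').
  by rewrite -{2}(subnK jk) exprD; field; rewrite !expf_neq0 // gt_eqF ?node_gt0.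
by field; rewrite !expf_neq0 // gt_eqF ?node_gt0.
Unshelve. all: by end_near. Qed.

End Assembly.

End Main.

Theorem theorem1p3 (R : realType) (k r : nat) (hr : (2 <= r)%N)
    (hk : (r <= k)%N) :
  (\sum_(t : r.-tuple 'I_k.+1 | is_composition t)
      (Z R (double_index t) + Z R (shifted_index t))
   = ((2 ^+ (2 * r - 3))^-1)%:E *
     \sum_(j < (r.-1)./2.+1)
       ((- (4 * pi ^+ 2)) ^+ j / (2 * j)`!%:R
          * 'C(2 * r - 2 * j - 2, r - 1)%:R)%:E
       * Z R [tuple (2 * k - 2 * j)%N])%E.
Proof.
have r0 : (0 < r)%N := ltnW hr.
have k0 : (0 < k)%N := leq_trans r0 hk.
have Zt0 (s n : r.-tuple nat) : 0 <= Zterm R s n.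
  rewrite ZtermE mulr_ge0 ?divr_ge0 ?invr_ge0 ?(ltW (wt_gt0 _ _)) //.
  by apply: prodr_ge0 => i _; rewrite exprn_ge0 // ltW ?node_gt0.
have jlt (j : 'I_r.-1./2.+1) : (j.*2 <= r.-1)%N by rewrite -geq_half_double -ltnS.
have jk (j : 'I_r.-1./2.+1) : (0 < k - j)%N.
  rewrite subn_gt0; apply: leq_ltn_trans (_ : r.-1 < k)%N.
    by apply: leq_trans (jlt j); rewrite -addnn leq_addr.
  by rewrite prednK.
pose z j : R := limn (fun N => \sum_(0 <= m < N) ((node R m ^+ 2) ^+ (k - j))^-1).
have zE (j : 'I_r.-1./2.+1) :
    \sum_(0 <= m < N) ((node R m ^+ 2) ^+ (k - j))^-1 @[N --> \oo] --> z j /\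
    Z R [tuple (2 * k - 2 * j)%N] = (z j)%:E.
  rewrite -mulnBr; have [x hx ->] := Z_depth1 R (jk j).
  by rewrite /z (cvg_lim _ hx).
have -> : (\sum_(t : r.-tuple 'I_k.+1 | is_composition t)
      (Z R (double_index t) + Z R (shifted_index t)) =
    \esum_(n in [set n : r.-tuple nat | sorted ltn n]) (total_weight R k r n)%:E)%E.
  rewrite (eq_esum (b := fun n : r.-tuple nat =>
    (\sum_(t : r.-tuple 'I_k.+1 | is_composition t)
      ((Zterm R (double_index t) n)%:E + (Zterm R (shifted_index t) n)%:E))%E)); last first.
    move=> n sn; rewrite -(sum_Zterm_compositions R r0 k0 sn) -sumEFin.
    by apply: eq_bigr => t _; rewrite EFinD.
  rewrite esum_sum; last by move=> n t _ _; rewrite adde_ge0 // lee_fin.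
  by apply: eq_bigr => t _; rewrite esumD // => n _; rewrite lee_fin.
have -> : (((2 ^+ (2 * r - 3))^-1)%:E *
     \sum_(j < (r.-1)./2.+1)
       ((- (4 * pi ^+ 2)) ^+ j / (2 * j)`!%:R
          * 'C(2 * r - 2 * j - 2, r - 1)%:R)%:E
       * Z R [tuple (2 * k - 2 * j)%N] =
   (\sum_(j < r.-1./2.+1) 2 * closed_coef R r.-1 j * z j)%:E)%E.
  have -> : (\sum_(j < (r.-1)./2.+1)
       ((- (4 * pi ^+ 2)) ^+ j / (2 * j)`!%:R
          * 'C(2 * r - 2 * j - 2, r - 1)%:R)%:E
       * Z R [tuple (2 * k - 2 * j)%N] =
     (\sum_(j < (r.-1)./2.+1) ((- (4 * pi ^+ 2)) ^+ j / (2 * j)`!%:R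
          * 'C(2 * r - 2 * j - 2, r - 1)%:R) * z j)%:E)%E.
    by rewrite -sumEFin; apply: eq_bigr => j _; rewrite (zE j).2 EFinM.
  rewrite -EFinM mulr_sumr; congr (_%:E); apply: eq_bigr => j _.
  rewrite mulrA; congr (_ * _); rewrite /closed_coef jlt.
  have -> : (2 * r - 2 * j - 2 = 2 * r.-1 - 2 * j)%N.
    have e : (2 * r.-1 = 2 * r - 2)%N by rewrite -subn1 mulnBr muln1.
    by rewrite e subnAC.
  have -> : (r - 1 = r.-1)%N by rewrite subn1.
  have -> : (2 ^+ (2 * r - 3))^-1 = 2 * 4 ^- r.-1 :> R.
    case: r hr {r0 hk Zt0 jlt jk z zE j} => [//|[//|s]] _.
    have -> : (2 * s.+2 - 3 = (2 * s).+1)%N by rewrite !mulnS !add2n.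
    have -> : 4 = 2 ^+ 2 :> R by ring.
    rewrite /= -exprM mulnS add2n !exprS; field.
    by rewrite expf_neq0.
  by ring.
rewrite (@esum_sorted_tuples R r (total_weight R k r) (\sum_(j < r.-1./2.+1) 2 * closed_coef R r.-1 j * z j)) //.
  move=> n sn; rewrite -sum_Zterm_compositions //; apply: sumr_ge0 => t _.
  by rewrite addr_ge0.
apply: sum_total_weight_cvg => [|j jr]; first by rewrite r0.
exact: (zE (Ordinal (jr : (j < r.-1./2.+1)%N))).1.
Qed.
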